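(* Let $k$ be an arbitrary field, let $Q$ be a finite quiver without loops, and let $\alpha$ be a positive real root for $Q$. Then the unique (up to isomorphism) indecomposable representation $X_\alpha$ of $Q$ over $k$ of dimension vector $\alpha$ is of maximal rank type.
   Context: A finite quiver $Q$ has finite vertex set $Q_0$, finite arrow set $Q_1$ and functions $h,t:Q_1\to Q_0$ assigning head and tail to each arrow; ''without loops'' means that no arrow $a$ has $t(a)=h(a)$. Multiple arrows and oriented cycles are allowed. For $i\in Q_0$ put $H^Q(i)=\{a\in Q_1: h(a)=i\}$ and $T^Q(i)=\{a\in Q_1: t(a)=i\}$. Representations are over $k$ and finite dimensional: a representation $X$ consists of finite dimensional vector spaces $X_i$ ($i\in Q_0$) and linear maps $X_a:X_{t(a)}\to X_{h(a)}$ ($a\in Q_1$); its dimension vector is $(\dim X_i)_{i\in Q_0}\in\mathbb{N}^{Q_0}$. Maximal rank type: $X$ is of maximal rank type if (i) for every $i\in Q_0$ and every subset $A\subseteq H^Q(i)$ the map $\bigoplus_{a\in A}X_{t(a)}\xrightarrow{(X_a)_a}X_i$ is of maximal rank (i.e. its rank is the minimum of the dimensions of source and target), and (ii) for every $i\in Q_0$ and every subset $B\subseteq T^Q(i)$ the map $X_i\xrightarrow{(X_b)_b}\bigoplus_{b\in B}X_{h(b)}$ is of maximal rank. Real roots: for $\alpha,\beta\in\mathbb{Z}^{Q_0}$ let $\langle\alpha,\beta\rangle=\sum_{i\in Q_0}\alpha[i]\beta[i]-\sum_{a\in Q_1}\alpha[t(a)]\beta[h(a)]$ and $(\alpha,\beta)=\langle\alpha,\beta\rangle+\langle\beta,\alpha\rangle$.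 Let $e_i$ be the coordinate vector at $i$ and $s_i(\alpha)=\alpha-(\alpha,e_i)e_i$. The Weyl group $W$ is the group generated by the $s_i$, $i\in Q_0$. A positive real root is an element $\alpha$ of the form $w(e_i)$ with $w\in W$, $i\in Q_0$, having all coordinates $\ge 0$. By a theorem of Kac and Schofield, for every positive real root $\alpha$ there is exactly one indecomposable representation of $Q$ over $k$ of dimension vector $\alpha$ up to isomorphism; it is denoted $X_\alpha$. *)

(* Defs.v *)
From HB Require Import structures.
From mathcomp Require Import all_boot all_order all_algebra.

Set Implicit Arguments.
Unset Strict Implicit.
Unset Printing Implicit Defensive.

Import GRing.Theory.
Local Open Scope ring_scope.

Record quiver := Quiver {
  vertex : finType;
  arrow : finType;
  head : arrow -> vertex;
  tail : arrow -> vertex }.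

Definition loopless (Q : quiver) := forall a : arrow Q, tail a != head a.

Definition arrows_in (Q : quiver) (i : vertex Q) : {set arrow Q} :=
  [set a | head a == i].

Definition arrows_out (Q : quiver) (i : vertex Q) : {set arrow Q} :=
  [set a | tail a == i].

(* MathComp provides the vector space [{ffun I -> V}] only for a constant
   family; this is the direct sum of a finite family of possibly different
   spaces, i.e. dependent functions with pointwise operations. *)
Section DirectSum.
Import VectorInternalTheory.
Variables (k : fieldType) (I : finType) (V : I -> vectType k).

Definition dirsum : Type := {dffun forall i, V i}.

HB.instance Definition _ := Choice.on dirsum.

Implicit Types (c : k) (u v w : dirsum).

Definition dirsum_fun v i : V i := (v : {dffun forall i, V i}) i.
Definition dirsum_mk (f : forall i, V i) : dirsum := [ffun i => f i].

Lemma dirsumE f i : dirsum_fun (dirsum_mk f) i = f i.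
Proof. by rewrite /dirsum_fun ffunE. Qed.

Lemma dirsumP u v : (forall i, dirsum_fun u i = dirsum_fun v i) <-> u = v.
Proof. by split=> [uv|-> //]; apply/ffunP. Qed.

Definition dirsum_zero := dirsum_mk (fun=> 0).
Definition dirsum_opp v := dirsum_mk (fun i => - dirsum_fun v i).
Definition dirsum_add u v :=
  dirsum_mk (fun i => dirsum_fun u i + dirsum_fun v i).
Definition dirsum_scale c v := dirsum_mk (fun i => c *: dirsum_fun v i).

Fact dirsum_addA : associative dirsum_add.
Proof. by move=> u v w; apply/dirsumP=> i; rewrite !dirsumE addrA. Qed.
Fact dirsum_addC : commutative dirsum_add.
Proof. by move=> u v; apply/dirsumP=> i; rewrite !dirsumE addrC. Qed.
Fact dirsum_add0 : left_id dirsum_zero dirsum_add.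
Proof. by move=> v; apply/dirsumP=> i; rewrite !dirsumE add0r. Qed.
Fact dirsum_addN : left_inverse dirsum_zero dirsum_opp dirsum_add.
Proof. by move=> v; apply/dirsumP=> i; rewrite !dirsumE addNr. Qed.

HB.instance Definition _ := GRing.isZmodule.Build dirsum
  dirsum_addA dirsum_addC dirsum_add0 dirsum_addN.

Fact dirsum_scaleA c d v :
  dirsum_scale c (dirsum_scale d v) = dirsum_scale (c * d) v.
Proof. by apply/dirsumP=> i; rewrite !dirsumE scalerA. Qed.
Fact dirsum_scale1 : left_id 1 dirsum_scale.
Proof. by move=> v; apply/dirsumP=> i; rewrite !dirsumE scale1r. Qed.
Fact dirsum_scaleDr : right_distributive dirsum_scale +%R.
Proof. by move=> c u v; apply/dirsumP=> i; rewrite !dirsumE scalerDr. Qed.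
Fact dirsum_scaleDl v : {morph dirsum_scale^~ v : c d / c + d}.
Proof. by move=> c d; apply/dirsumP=> i; rewrite !dirsumE scalerDl. Qed.

HB.instance Definition _ := GRing.Zmodule_isLmodule.Build k dirsum
  dirsum_scaleA dirsum_scale1 dirsum_scaleDr dirsum_scaleDl.

Lemma dirsum_funP i c u v :
  dirsum_fun (c *: u + v) i = c *: dirsum_fun u i + dirsum_fun v i.
Proof. by rewrite !dirsumE. Qed.

Fact dirsum_vect_iso :
  Vector.axiom (\sum_(j < #|I|) dim (V (enum_val j))) dirsum.
Proof.
pose fr (v : dirsum) := \mxrow_(j < #|I|) v2r (dirsum_fun v (enum_val j)).
pose gr (r : 'rV[k]_(\sum_(j < #|I|) dim (V (enum_val j)))) :=
  dirsum_mk (fun i => ecast i (V i) (enum_rankK i)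
                        (r2v (submxrow r (enum_rank i)))).
exists fr => [c u v|].
  apply/mxrowP=> j; rewrite /fr mxrowK dirsum_funP linearP.
  have -> (A B : 'rV[k]_(\sum_(j < #|I|) dim (V (enum_val j)))) :
    submxrow (c *: A + B) j = c *: submxrow A j + submxrow B j.
    by apply/matrixP=> x y; rewrite !mxE.
  by rewrite !mxrowK.
exists gr => [v|r].
  apply/dirsumP=> i; rewrite dirsumE /fr mxrowK v2rK.
  move: (enum_rankK i); move: (enum_val _) => j e.
  by case: _ / e.
apply/mxrowP=> j; rewrite /fr mxrowK dirsumE.
apply: (canLR r2vK).
move: (enum_rankK _) (enum_valK j) => /=; move: (enum_rank _) => j' e e'.
by case: _ / {e'}(esym e') e => e; rewrite eq_axiomK.
Qed.

HB.instance Definition _ :=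
  Lmodule_hasFinDim.Build k dirsum dirsum_vect_iso.

End DirectSum.

Definition max_rank (k : fieldType) (V W : vectType k) (f : 'Hom(V, W)) :=
  \dim (limg f) = minn (\dim {: V}) (\dim {: W}).

Section Representations.
Variables (k : fieldType) (Q : quiver).

Record rep := Rep {
  rep_space :> vertex Q -> vectType k;
  rep_map : forall a : arrow Q, 'Hom(rep_space (tail a), rep_space (head a)) }.

Implicit Types X Y Z : rep.

Definition dim_vector X : {ffun vertex Q -> int} :=
  [ffun i => (\dim {: X i})%:Z].

Definition isomorphic X Y :=
  exists f : forall i, 'Hom(X i, Y i),
    (forall i, bijective (f i)) /\
    (forall a x, f (head a) (rep_map X a x) = rep_map Y a (f (tail a) x)).

Definition rep_sum_fun Y Z a (v : Y (tail a) * Z (tail a)) :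
  Y (head a) * Z (head a) := (rep_map Y a v.1, rep_map Z a v.2).

Fact rep_sum_fun_linear Y Z a : linear (@rep_sum_fun Y Z a).
Proof. by move=> c u v; rewrite /rep_sum_fun !linearP. Qed.

HB.instance Definition _ Y Z a := GRing.isLinear.Build k _ _ _
  (@rep_sum_fun Y Z a) (@rep_sum_fun_linear Y Z a).

Definition rep_sum Y Z : rep :=
  @Rep (fun i => (Y i * Z i)%type : vectType k)
       (fun a => linfun (@rep_sum_fun Y Z a)).

Definition zero_rep X := forall i, \dim {: X i} = 0%N.

Definition indecomposable X :=
  ~ zero_rep X /\
  forall Y Z, isomorphic X (rep_sum Y Z) -> zero_rep Y \/ zero_rep Z.

(* For [head a = i] (resp. [tail a = i]) only propositionally, the map X_a is
   transported to have the space at [i] as its target (resp. source). *)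
Definition map_to X i a (e : head a = i) : 'Hom(X (tail a), X i) :=
  ecast j 'Hom(X (tail a), X j) e (rep_map X a).

Definition map_from X i a (e : tail a = i) : 'Hom(X i, X (head a)) :=
  ecast j 'Hom(X j, X (head a)) e (rep_map X a).

Lemma head_in i (A : {set arrow Q}) (sA : A \subset arrows_in i)
  (a : {a | a \in A}) : head (val a) = i.
Proof. by apply/eqP; move/subsetP/(_ _ (valP a)): sA; rewrite inE. Qed.

Lemma tail_out i (B : {set arrow Q}) (sB : B \subset arrows_out i)
  (b : {b | b \in B}) : tail (val b) = i.
Proof. by apply/eqP; move/subsetP/(_ _ (valP b)): sB; rewrite inE. Qed.

Definition in_fun X i (A : {set arrow Q}) (sA : A \subset arrows_in i)
    (v : dirsum (fun a : {a | a \in A} => X (tail (val a)))) : X i :=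
  \sum_a map_to X (head_in sA a) (dirsum_fun v a).

Fact in_fun_linear X i A sA : linear (@in_fun X i A sA).
Proof.
move=> c u v; rewrite /in_fun scaler_sumr -big_split /=.
by apply: eq_bigr => a _; rewrite dirsum_funP linearP.
Qed.

HB.instance Definition _ X i A sA := GRing.isLinear.Build k _ _ _
  (@in_fun X i A sA) (@in_fun_linear X i A sA).

Definition out_fun X i (B : {set arrow Q}) (sB : B \subset arrows_out i)
    (x : X i) : dirsum (fun b : {b | b \in B} => X (head (val b))) :=
  dirsum_mk (fun b => map_from X (tail_out sB b) x).

Fact out_fun_linear X i B sB : linear (@out_fun X i B sB).
Proof.
by move=> c x y; apply/dirsumP=> b; rewrite dirsum_funP !dirsumE linearP.
Qed.

HB.instance Definition _ X i B sB := GRing.isLinear.Build k _ _ _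
  (@out_fun X i B sB) (@out_fun_linear X i B sB).

Definition max_rank_type X :=
  (forall i (A : {set arrow Q}) (sA : A \subset arrows_in i),
      max_rank (linfun (@in_fun X i A sA))) /\
  (forall i (B : {set arrow Q}) (sB : B \subset arrows_out i),
      max_rank (linfun (@out_fun X i B sB))).

End Representations.

Section RealRoots.
Variable Q : quiver.

Notation lattice := {ffun vertex Q -> int}.

Implicit Types alpha beta : lattice.

Definition euler_form alpha beta : int :=
  \sum_i alpha i * beta i - \sum_(a : arrow Q) alpha (tail a) * beta (head a).

Definition sym_form alpha beta : int :=
  euler_form alpha beta + euler_form beta alpha.

Definition simple_root (i : vertex Q) : lattice := [ffun j => (j == i)%:Z].

Definition reflection (i : vertex Q) alpha : lattice :=
  alpha - simple_root i *~ sym_form alpha (simple_root i).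

Inductive weyl : (lattice -> lattice) -> Prop :=
| weyl_id : weyl id
| weyl_reflection i : weyl (reflection i)
| weyl_comp w w' : weyl w -> weyl w' -> weyl (w \o w')
| weyl_inv w w' : weyl w -> cancel w w' -> cancel w' w -> weyl w'.

Definition positive_real_root alpha :=
  (exists w i, weyl w /\ alpha = w (simple_root i)) /\
  (forall i, 0 <= alpha i).

End RealRoots.

(* Main.v *)
Require Import Defs.
From HB Require Import structures.
From mathcomp Require Import all_boot all_order all_algebra all_field.
From mathcomp Require Import cyclic.
From mathcomp Require Import ring zify.
From Stdlib Require Import Classical.

(** Real roots have Tits form 1, and the proof only uses this. Suppose that the
    map [Phi] from the direct sum of the spaces at the tails of some arrows into
    a vertex [i], between spaces of dimensions [d] and [c], has rank [r] smaller
    than both. Insert a new vertex carrying the image of [Phi], make these arrows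
    end there, and add the inclusion of the image as a new arrow. The resulting
    representation has the same endomorphism ring, hence is indecomposable, and
    its Tits form is [1 + (d - r) * (c - r)], which is at least 2
    ([mxindec_max_rank]). Maps out of a vertex are handled by transposition. So
    everything rests on Kac's bound, [mxindec_tits_le1]: the Tits form of an
    indecomposable representation with coprime dimensions is at most 1, over any
    field.

    Kac's bound is an induction on the total dimension. If the dimension [c] at
    every vertex is at most half the total dimension of its neighbours, the form
    is nonpositive. Otherwise, at some vertex [c] is larger. Were this vertex a
    sink, the reflection functor ([mxrep_reflect]) would replace [c] by the
    dimension of the neighbours minus [c], preserving the form, coprimality and
    indecomposability. To make it a sink the quiver is reoriented, which uses a
    count over finite fields.

    Reduction to a finite field ([mxrep_specialize]): as the dimensions are
    coprime, the endomorphisms are the scalars plus a nilpotent ideal. This is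
    witnessed by finitely many polynomial identities between elements of the
    field, and a finitely generated subring of a field maps to a finite field.

    Reorientation ([mxindec_reorient]): over a finite field [F], consider the
    pairs [(x, g)] of a representation with given projections and an automorphism
    [g] of it, and a generic character of the product of the general linear
    groups at the vertices, trivial on scalars, with values in a cyclic group of
    large prime order [l]. On the automorphism group of an indecomposable [x] the
    character is trivial; on that of a decomposable [x] it is equidistributed.
    Thus the excess of pairs with value 1 over pairs with another given value is
    positive exactly when an indecomposable representation exists. For a fixed
    [g], the representations fixed by [g] are a product over the arrows of spaces
    of matrices [y] with [g y = y g], of the same cardinality when an arrow is
    reversed, by duality for the trace form. So the excess does not depend on the
    orientation. The exponents of the character come from [generic_weights]. *)

Set Implicit Arguments.
Unset Strict Implicit.
Unset Printing Implicit Defensive.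
Import Order.TTheory GRing.Theory Num.Theory.
Local Open Scope ring_scope.

(** * Specializing finitely many scalars to a finite field *)

Lemma irreducible_factor (F : fieldType) (p : {poly F}) :
  (1 < size p)%N -> exists2 r, irreducible_poly r & r %| p.
Proof.
have [n] := ubnP (size p); elim: n p => // n IHn p le_p sp.
case: (classic (irreducible_poly p)) => [irr_p | red_p]; first by exists p.
have [q [sq qp neq]] : exists q : {poly F}, [/\ size q != 1, q %| p & ~ (q %= p)].
  apply: NNPP => nq; apply: red_p; split=> // q sq qp.
  by apply/negP => /negP neq; apply: nq; exists q; split=> //; apply/negP.
have p0 : p != 0 by rewrite -size_poly_gt0 (ltn_trans _ sp).
have q0 : q != 0 by apply: contraNneq p0 => q0; rewrite q0 dvd0p in qp.
have sq1 : (1 < size q)%N by rewrite ltn_neqAle eq_sym sq size_poly_gt0.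
have [|r irr_r rq] := IHn q _ sq1; last by exists r => //; apply: dvdp_trans qp.
rewrite (leq_trans _ (le_p : (size p <= n)%N)) // ltn_neqAle dvdp_leq // andbT.
by apply/negP => /eqP ss; apply: neq; rewrite -dvdp_size_eqp // ss.
Qed.

(** Splitting fields of finite fields are finite; this is what keeps the fields
    below finite when a root is adjoined. *)
Lemma finField_root (F : finFieldType) (p : {poly F}) : (1 < size p)%N ->
  exists (L : finFieldType) (j : {rmorphism F -> L}) (w : L),
    root (map_poly j p) w.
Proof.
move=> sp; have p0 : p != 0 by rewrite -size_poly_gt0 (ltn_trans _ sp).
have [L [zs Dp _]] := FinSplittingFieldFor p0.
exists (FinFieldExtType L), (in_alg L : {rmorphism F -> L}).
case: zs Dp => [|z zs Dp].
  rewrite big_nil => /eqp_size; rewrite size_map_poly size_poly1 => sp1.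
  by rewrite sp1 in sp.
by exists z; rewrite (eqp_root Dp) root_prod_XsubC inE eqxx.
Qed.

(** Every point of [B] in a field can be replaced by a point in a finite field,
    keeping every equation and one chosen inequation, which makes room for an
    induction on the number of variables. *)
Definition specializable (B : idomainType) :=
  forall (k : fieldType) (eps : {rmorphism B -> k}) (s : B), eps s != 0 ->
  exists (F : finFieldType) (phi : {rmorphism B -> F}),
    phi s != 0 /\ (forall b, eps b = 0 -> phi b = 0).

Lemma intr_eq0_pchar (R : fieldType) (p : nat) (b : int) :
  p \in [pchar R] -> (b%:~R == 0 :> R) = (p %| `|b|)%N.
Proof.
move=> charp; rewrite {1}[b]intEsign rmorphM /= rmorph_sign mulf_eq0 signr_eq0 /=.
by rewrite (dvdn_pcharf charp).
Qed.

Lemma int_specializable : specializable int.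
Proof.
move=> k eps s eps_s.
have epsE b : eps b = b%:~R by rewrite -[b in LHS]intz rmorph_int.
have s0 : s != 0 by apply: contraNneq eps_s => ->; rewrite rmorph0.
have [p pr_p [sp ker_p]] : exists2 p, prime p &
    ~~ (p %| `|s|)%N /\ forall b, eps b = 0 -> (p %| `|b|)%N.
  case: (classic (exists p, p \in [pchar k])) => [[p charp] | char0].
    exists p; first exact: pcharf_prime charp.
    split=> [|b /eqP]; first by rewrite -(intr_eq0_pchar _ charp) -epsE.
    by rewrite epsE (intr_eq0_pchar _ charp).
  have [p ltp pr_p] := prime_above `|s|; exists p => //; split=> [|b /eqP b0].
    by apply/negP => /dvdn_leq le_p; move: ltp; rewrite ltnNge le_p // absz_gt0.
  suff -> : b = 0 by rewrite dvdn0.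
  apply/eqP; apply/negPn/negP => nb; apply: char0.
  have: (`|b|%:R == 0 :> k).
    move: b0; rewrite epsE {1}[b]intEsign rmorphM /= rmorph_sign.
    by rewrite mulf_eq0 signr_eq0.
  by apply: natf0_pchar; rewrite absz_gt0.
exists 'F_p, (intmul 1 : {rmorphism int -> 'F_p}) => /=.
have zp b := intr_eq0_pchar b (pchar_Fp pr_p).
by split=> [|b /ker_p pb]; rewrite ?zp //; apply/eqP; rewrite zp.
Qed.

Section PolySpecializable.
Variables (B : idomainType) (k : fieldType) (eps : {rmorphism {poly B} -> k}).
Local Notation eps0 := (eps \o polyC).
Import Pdiv.Idomain.

(** Leading terms killed by [eps] may be dropped, so divisions below only need
    remainders whose leading coefficient survives. *)
Lemma eps_trunc (r : {poly B}) :
  (forall i, eps (r`_i)%:P = 0) \/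
  exists r' : {poly B},
    [/\ (size r' <= size r)%N, eps r' = eps r & eps (lead_coef r')%:P != 0].
Proof.
have [n] := ubnP (size r); elim: n r => // n IHn r le_r.
have [/eqP l0|l1] := boolP (eps (lead_coef r)%:P == 0); last by right; exists r.
have [->|r0] := eqVneq r 0.
  by left=> i; rewrite coef0 polyC0 rmorph0.
pose d := (size r).-1; pose r1 := r - (lead_coef r)%:P * 'X^d.
have sr : size r = d.+1 by rewrite prednK // size_poly_gt0.
have r1i i : r1`_i = if i == d then 0 else r`_i.
  rewrite coefB coefCM coefXn; case: eqP => [->|_]; last by rewrite mulr0 subr0.
  by rewrite mulr1 /lead_coef -/d subrr.
have sr1 : (size r1 <= d)%N.
  apply/leq_sizeP => j dj; rewrite r1i; case: eqP => // /eqP ne.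
  by rewrite nth_default // sr ltn_neqAle eq_sym ne.
have er1 : eps r1 = eps r by rewrite rmorphB rmorphM l0 mul0r subr0.
case: (IHn r1) => [|all0|[r' [sr' er' lr']]].
- by rewrite (leq_ltn_trans sr1) // -ltnS -sr.
- left=> i; have := all0 i; rewrite r1i; case: eqP => // -> _.
  by rewrite -[r`_d]/(lead_coef r).
- right; exists r'; rewrite er' er1; split=> //.
  by rewrite sr (leq_trans sr') // (leq_trans sr1).
Qed.

Lemma eps_coef0 (r : {poly B}) : (forall i, eps (r`_i)%:P = 0) -> eps r = 0.
Proof.
move=> r0; rewrite -[r]coefK poly_def rmorph_sum big1 // => i _.
by rewrite -mul_polyC rmorphM r0 mul0r.
Qed.

(** The substitute for the minimal polynomial of the image of ['X] over the
    fraction field of the image of [B]. *)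
Definition min_rel (p : {poly B}) := [/\ eps p = 0, eps (lead_coef p)%:P != 0 &
  forall g, eps g = 0 -> eps (lead_coef g)%:P != 0 -> (size p <= size g)%N].

Lemma eps_lead_neq0 (p : {poly B}) : eps (lead_coef p)%:P != 0 -> p != 0.
Proof. by apply: contraNneq => ->; rewrite lead_coef0 rmorph0. Qed.

Lemma ex_min_size (P : {poly B} -> Prop) p : P p ->
  exists2 q, P q & forall g, P g -> (size q <= size g)%N.
Proof.
have [n] := ubnP (size p); elim: n p => // n IHn p le_p Pp.
case: (classic (exists2 g, P g & (size g < size p)%N)) => [[g Pg lt_g]|no].
  by apply: (IHn g) => //; rewrite (leq_trans lt_g).
exists p => // g Pg; rewrite leqNgt; apply/negP => lt_g; apply: no.
by exists g.
Qed.

(** By minimality the remainder of a pseudo-division by [p] is killed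
    coefficientwise. Hence a root of [p], over a specialization of [B] where
    [lead_coef p] survives, satisfies all the relations of the image of ['X]. *)
Lemma min_rel_mod p g : min_rel p -> eps g = 0 ->
  exists m q t, [/\ lead_coef p ^+ m *: g = q * p + t
                   & forall i, eps (t`_i)%:P = 0].
Proof.
case=> p0 lp minp g0; exists (scalp g p), (g %/ p), (g %% p).
split; first exact: divp_eq.
have et : eps (g %% p) = 0.
  have /(congr1 eps) := divp_eq g p.
  by rewrite rmorphD rmorphM p0 mulr0 add0r -mul_polyC rmorphM g0 mulr0.
case: (eps_trunc (g %% p)) => // -[r' [sr' er' lr']].
have := minp r' (etrans er' et) lr'; rewrite leqNgt.
by rewrite (leq_ltn_trans sr') // ltn_modp eps_lead_neq0.
Qed.

(** The image of [s] is algebraic over that of [B], hence divides a nonzero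
    constant. The multiple of [s] of minimal size is that constant: dividing [p]
    by a longer one would produce a relation shorter than [p]. *)
Lemma min_rel_inv p s : min_rel p -> eps s != 0 ->
  exists u c, eps c%:P != 0 /\ eps (s * u) = eps c%:P.
Proof.
move=> minp s0; have [p0 lp minpP] := minp.
pose P r := eps (lead_coef r)%:P != 0 /\ exists u, eps r = eps (s * u).
have [|r [lr [u eru]] minr] := @ex_min_size P p.
  by split=> //; exists 0; rewrite mulr0 rmorph0.
have tzero (t : {poly B}) : (size t < size r)%N -> (exists u, eps t = eps (s * u)) -> eps
  t = 0.
  move=> st [v etv]; case: (eps_trunc t) => [/eps_coef0 //|[t' [st' et' lt']]].
  have /minr : P t' by split=> //; exists v; rewrite et'.
  by rewrite leqNgt (leq_ltn_trans st').
have r0 := eps_lead_neq0 lr.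
have [sr1|sr1] := leqP (size r) 1.
  move: lr eru; rewrite (size1_polyC sr1) lead_coefC => lr eru.
  by exists u, (r`_0).
have [er0|er0] := eqVneq (eps r) 0.
  have eqd := divp_eq s r; have /(congr1 eps) := eqd.
  rewrite rmorphD rmorphM er0 mulr0 add0r -mul_polyC rmorphM => emod.
  have /eqP : eps (s %% r) = 0.
    apply: tzero; first by rewrite ltn_modp.
    by exists (lead_coef r ^+ scalp s r)%:P; rewrite -emod -rmorphM mulrC.
  by rewrite -emod mulf_eq0 (negPf s0) orbF polyC_exp rmorphXn expf_eq0 (negPf lr) andbF.
have eqd := divp_eq p r; have := congr1 eps eqd.
rewrite rmorphD rmorphM -mul_polyC rmorphM p0 mulr0 => emod.
have em0 : eps (p %% r) = 0.
  apply: tzero; first by rewrite ltn_modp.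
  exists (- (p %/ r) * u); rewrite mulrCA rmorphM -eru rmorphN mulNr.
  by apply/eqP; rewrite -addr_eq0 addrC -emod.
move/esym/eqP: emod; rewrite em0 addr0 mulf_eq0 (negPf er0) orbF => /eqP eq0.
have p_neq0 := eps_lead_neq0 lp.
have srp : (size r <= size p)%N.
  by apply: minr; split=> //; exists 0; rewrite mulr0 rmorph0.
have lcm : lead_coef r ^+ scalp p r != 0 by rewrite expf_neq0 // lead_coef_eq0.
have q0 : p %/ r != 0 by rewrite divp_eq0 (negPf p_neq0) (negPf r0) ltnNge srp.
have smod : (size (p %% r)%R < size (p %/ r * r)%R)%N.
  by rewrite (leq_trans (_ : (_ < size r)%N)) ?ltn_modp // size_mul // -subn1 addnC
    -addnBA ?leq_addr ?size_poly_gt0.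
have lq : lead_coef (p %/ r) * lead_coef r = lead_coef r ^+ scalp p r * lead_coef p.
  by rewrite -lead_coefM -(lead_coefDl smod) -eqd lead_coefZ.
have lq0 : eps (lead_coef (p %/ r))%:P != 0.
  have /(congr1 (fun x => eps x%:P)) := lq; rewrite !polyCM polyC_exp !rmorphM rmorphXn.
  move=> e1; apply: contraNneq lp => l0; move/eqP: e1; rewrite l0 mul0r eq_sym mulf_eq0.
  by rewrite expf_eq0 (negPf lr) andbF.
have := minpP _ eq0 lq0; rewrite leqNgt => /negP[].
have: size (p %/ r * r)%R = size p.
  by rewrite -(size_polyDl smod) -eqd size_scale.
rewrite size_mul // => <-; move: sr1; case: (size r) => [|[|m]] //.
by move=> _; rewrite !addnS /= ltnS leq_addr.
Qed.

Hypothesis goodB : specializable B.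

Lemma poly_specializable_aux s : eps s != 0 ->
  exists (F : finFieldType) (phi : {rmorphism {poly B} -> F}),
    phi s != 0 /\ (forall b, eps b = 0 -> phi b = 0).
Proof.
move=> s0; pose epsC : {rmorphism B -> k} := eps \o polyC.
(* Either the image of ['X] is algebraic over that of [B], or it is transcendental. *)
case: (classic (exists2 g, eps g = 0 & eps (lead_coef g)%:P != 0)).
  case=> g0 eg0 lg0.
  have [p [p0 lp] minP] := @ex_min_size
    (fun g => eps g = 0 /\ eps (lead_coef g)%:P != 0) g0 (conj eg0 lg0).
  have minp : min_rel p by split=> // g e1 e2; apply: minP.
  have [u [c [c0 ec]]] := min_rel_inv minp s0.
  have [|F0 [phi0 [phi0lc ker0]]] := goodB (eps := epsC) (s := lead_coef p * c).
    by rewrite rmorphM mulf_neq0.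
  have phi0l : phi0 (lead_coef p) != 0 by apply: contraNneq phi0lc => e; rewrite rmorphM
    e mul0r.
  have phi0c : phi0 c != 0 by apply: contraNneq phi0lc => e; rewrite rmorphM e mulr0.
  have sp : size (map_poly phi0 p) = size p by rewrite size_map_poly_id0.
  have [|F [j [w rootw]]] := @finField_root F0 (map_poly phi0 p).
    rewrite sp ltnNge; apply/negP => sp1; move: lp p0.
    by rewrite (size1_polyC sp1) lead_coefC => /negPf e /eqP; rewrite e.
  pose phi : {rmorphism {poly B} -> F} := horner_eval w \o map_poly (j \o phi0).
  have phiC b : phi b%:P = j (phi0 b) by rewrite /phi /= map_polyC /horner_eval hornerC.
  have phi_co (t : {poly B}) : (forall i, eps (t`_i)%:P = 0) -> phi t = 0.
    move=> t0; rewrite /phi /= (_ : map_poly _ _ = 0) ?/horner_eval ?horner0 //.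
    by apply/polyP=> i; rewrite coef_map coef0 /= ker0 ?rmorph0 //; apply: t0.
  have phip : phi p = 0 by apply/eqP; rewrite /phi /= map_poly_comp.
  clearbody phi.
  have ker g : eps g = 0 -> phi g = 0.
    move=> eg; have [m [q [t [eqg t0]]]] := min_rel_mod minp eg.
    have /eqP : phi ((lead_coef p ^+ m)%:P * g) = phi (q * p + t).
      by rewrite mul_polyC eqg.
    rewrite (rmorphD phi) !(rmorphM phi) phip mulr0 add0r (phi_co t) //.
    by rewrite phiC !rmorphXn mulf_eq0 expf_eq0 fmorph_eq0 (negPf phi0l) andbF => /eqP.
  exists F, phi; split=> //; apply: contraNneq phi0c => ps.
  have /eqP : phi (s * u - c%:P) = 0 by apply: ker; rewrite rmorphB ec subrr.
  by rewrite (rmorphB phi) (rmorphM phi) ps mul0r sub0r phiC oppr_eq0 fmorph_eq0.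
move=> norel; have kerC g : eps g = 0 -> forall i, eps (g`_i)%:P = 0.
  move=> eg; case: (eps_trunc g) => // -[r' [_ er' lr']].
  by case: norel; exists r'; rewrite ?er'.
have [i si] : exists i, eps (s`_i)%:P != 0.
  apply: NNPP => no; move/negP: s0; apply; rewrite eps_coef0 // => i.
  by apply/eqP/negPn/negP => si; apply: no; exists i.
have [F0 [phi0 [phi0s ker0]]] := goodB (eps := epsC) si.
have map0 g : eps g = 0 -> map_poly phi0 g = 0.
  move=> eg; apply/polyP => m; rewrite coef_map coef0 /= ker0 //; apply: (kerC g eg m).
have s1 : map_poly phi0 s != 0.
  by apply: contraNneq phi0s => /polyP/(_ i); rewrite coef_map coef0 => ->.
have [F [j [w nw]]] : exists (F : finFieldType) (j : {rmorphism F0 -> F}) (w : F),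
    ~~ root (map_poly j (map_poly phi0 s)) w.
  set q := map_poly phi0 s in s1 *.
  have [sq|sq] := leqP (size q) 1.
    exists F0, idfun, 0; rewrite map_poly_id //.
    by move: s1; rewrite (size1_polyC sq) rootC polyC_eq0.
  (* A root of [q - 1] is not a root of [q]. *)
  have [|F [j [w rw]]] := @finField_root F0 (q - 1).
    by rewrite size_polyDl // size_polyN size_poly1.
  exists F, j, w; move: rw; rewrite /root (rmorphB (map_poly j)) rmorph1 hornerD.
  by rewrite hornerN hornerC subr_eq0 => /eqP->; rewrite oner_eq0.
pose phi : {rmorphism {poly B} -> F} := horner_eval w \o map_poly (j \o phi0).
exists F, phi.
split=> [|b /map0 b0] /=; first by rewrite map_poly_comp.
by rewrite map_poly_comp b0 /horner_eval rmorph0 horner0.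
Qed.

End PolySpecializable.

Lemma poly_specializable (B : idomainType) :
  specializable B -> specializable {poly B}.
Proof. by move=> goodB k eps s; apply: poly_specializable_aux. Qed.

Lemma specialize_seq (k : fieldType) (xs : seq k) :
  exists (B : idomainType) (eps : {rmorphism B -> k}) (lift : k -> B),
    specializable B /\ {in xs, cancel lift eps}.
Proof.
elim: xs => [|x xs [B [eps [lift [goodB liftK]]]]].
  exists int, (intmul 1 : {rmorphism int -> k}), (fun=> 0).
  by split=> //; apply: int_specializable.
pose eps' : {rmorphism {poly B} -> k} := horner_eval x \o map_poly eps.
exists {poly B}, eps', (fun y => if y == x then 'X else (lift y)%:P).
split=> [|y]; first exact: poly_specializable.
rewrite inE /=; case: eqP => [->|_] /= yxs.
  by rewrite map_polyX /horner_eval hornerX.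
rewrite map_polyC /horner_eval hornerC; exact: liftK.
Qed.

(** * Matrices annihilated by a power of an irreducible polynomial *)

Lemma dvdp_irreducible_exp (F : fieldType) (r p : {poly F}) m :
  irreducible_poly r -> p %| r ^+ m -> exists s, p %= r ^+ s.
Proof.
move=> irr_r; elim: m p => [|m IHm] p; first by rewrite expr0 dvdp1 size_poly_eq1; exists
  0%N.
have [rp|rp] := boolP (r %| p); last first.
  rewrite exprS Gauss_dvdpr; first exact: IHm.
  by rewrite coprimep_sym irreducible_poly_coprime.
rewrite -(divpK rp) exprSr dvdp_mul2r ?irredp_neq0 // => /IHm[s ps].
by exists s.+1; rewrite exprSr eqp_mul2r ?irredp_neq0.
Qed.

(** [r(X)^m] times the identity factors through [X - g], so [char_poly g]
    divides a power of [r]. *)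
Lemma char_poly_irreducible_exp (F : fieldType) n (g : 'M[F]_n.+1) r m :
  irreducible_poly r -> horner_mx g (r ^+ m) = 0 ->
  exists s, char_poly g %= r ^+ s.
Proof.
move=> irr_r gr0; have [phi [bij_phi phiZ phiC _]] := mx_poly_ring_isom F n.
have [psi phiK psiK] := bij_phi.
have [q eq_q] : exists q, map_poly scalar_mx (r ^+ m) = q * ('X - g%:P).
  by apply/factor_theorem/rootP.
have eq_m : (r ^+ m)%:M = psi q *m char_poly_mx g.
  apply: (bij_inj bij_phi); rewrite -[_ *m _]/(psi q * char_poly_mx g) rmorphM psiK.
  by rewrite rmorphB phiC !phiZ map_polyX -eq_q.
apply: (dvdp_irreducible_exp (m := m * n.+1)) => //.
rewrite exprM -det_scalar eq_m det_mulmx; exact: dvdp_mulIr.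
Qed.

Lemma irreducible_size_dvd (F : fieldType) n (g : 'M[F]_n.+1) r m :
  irreducible_poly r -> horner_mx g (r ^+ m) = 0 -> ((size r).-1 %| n.+1)%N.
Proof.
move=> irr_r /(char_poly_irreducible_exp irr_r)[s /eqp_size].
rewrite size_char_poly => /(congr1 predn) /= ->.
by rewrite size_exp dvdn_mulr.
Qed.

Lemma det_scalar_nilp (F : fieldType) n (g : 'M[F]_n) c m :
  (g - c%:M) ^+ m = 0 -> \det g = c ^+ n.
Proof.
case: n g => [g _|n g gm0]; first by rewrite det_mx00.
have irr := irredp_XsubC c.
have [|s /eqpP[[a b] /= /andP[a0 b0] eq_s]] := @char_poly_irreducible_exp F n g ('X -
  c%:P) m irr.
  by rewrite rmorphXn rmorphB /= horner_mx_X horner_mx_C.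
have eq_c : char_poly g = ('X - c%:P) ^+ s.
  have /(congr1 lead_coef) := eq_s; rewrite !lead_coefZ.
  rewrite (monicP (char_poly_monic _)) (monicP (monic_exp _ (monicXsubC _))) !mulr1 => eab.
  by apply: (scalerI a0); rewrite eq_s eab.
have sn : s = n.+1.
  have /(congr1 (fun p : {poly F} => (size p).-1)) := eq_c.
  by rewrite size_char_poly size_exp size_XsubC mul1n.
have /(congr1 (fun p : {poly F} => p.[0])) := eq_c.
rewrite !horner_coef0 char_poly_det -!horner_coef0 !hornerE sn -[- c]mulN1r exprMn
  ?expr1n ?mulr1.
by move=> /mulfI ->; rewrite // signr_eq0.
Qed.

Lemma mxdet_sylvester (F : fieldType) n r (C : 'M[F]_(n, r)) (R : 'M[F]_(r, n)) :
  \det (1%:M + C *m R) = \det (1%:M + R *m C).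
Proof.
pose M := block_mx 1%:M (- C) R 1%:M; pose L := block_mx (1%:M : 'M_n) 0 (- R) (1%:M :
  'M_r).
have dL : \det L = 1 by rewrite det_lblock !det1 mulr1.
have : \det (M *m L) = \det (L *m M) by rewrite !det_mulmx mulrC.
rewrite !mulmx_block !(mul1mx, mulmx1, mul0mx, mulmx0, mulNmx, mulmxN).
rewrite !(opprK, addr0, add0r, addrN, addNr) det_ublock det_ublock !det1.
by rewrite mulr1 mul1r [R *m C + _]addrC.
Qed.

Lemma idempotent_base (F : fieldType) n (E : 'M[F]_n) :
  E *m E = E -> row_base E *m col_base E = 1%:M.
Proof.
move=> EE; apply: (row_free_inj (row_base_free E)); apply: (row_full_inj (col_base_full E)).
rewrite mul1mx mulmx_base -(mulmxA (row_base E)) mulmx_base.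
by rewrite (mulmxA (col_base E)) mulmx_base.
Qed.

Lemma det_idempotent (F : fieldType) n (E : 'M[F]_n) (a : F) :
  E *m E = E -> \det (a *: E + (1%:M - E)) = a ^+ \rank E.
Proof.
move=> EE; have RC := idempotent_base EE.
have -> : a *: E + (1%:M - E) = 1%:M + ((a - 1) *: col_base E) *m row_base E.
  by rewrite -scalemxAl mulmx_base scalerBl scale1r addrCA.
by rewrite mxdet_sylvester -scalemxAr RC scalemx1 -raddfD /= addrC subrK det_scalar.
Qed.

(** Fitting's lemma. With [p = q 'X^m] the minimal polynomial of [y] and
    [q.[0] != 0], the idempotent is the Bezout term divisible by [q]. *)
Lemma fitting_idempotent (F : fieldType) n (y : 'M[F]_n.+1) :
  exists w, let e := horner_mx y w in
    [/\ e *m e = e, e = 1 -> exists m, y ^+ m = 0 & e = 0 -> y \in unitmx].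
Proof.
have [m [q]] := multiplicity_XsubC (mxminpoly y) 0.
rewrite monic_neq0 ?mxminpoly_monic //= subr0 => q0 eq_p.
have cop : coprimep q ('X ^+ m.+1).
  by rewrite coprimep_expr // -[X in coprimep _ X]subr0 coprimep_XsubC.
have /Bezout_eq1_coprimepP[[u v] /= uv1] := cop.
have hp := mx_root_minpoly y; have hX := horner_mx_X y.
pose h : {rmorphism {poly F} -> 'M[F]_n.+1} := horner_mx y.
exists (u * q) => /=.
rewrite -[horner_mx y _]/(h _) in hp; rewrite -[horner_mx y _]/(h _) in hX.
rewrite -[horner_mx y _]/(h _).
move: h hp hX => h hp hX; rewrite -[_ *m _]/(_ * _).
have huv : h (u * q) + h (v * 'X ^+ m.+1) = 1 by rewrite -rmorphD uv1 rmorph1.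
have hqX : h (q * 'X ^+ m.+1) = 0.
  by rewrite exprSr mulrA -eq_p rmorphM hp mul0r.
split=> [|e1|e0].
- rewrite -[RHS]mulr1 -[X in _ = _ * X]huv mulrDr -[X in _ = _ + X]rmorphM.
  have -> : u * q * (v * 'X^(m.+1)) = (u * v) * (q * 'X^(m.+1)) :> {poly F} by ring.
  by rewrite (rmorphM h (u * v)) hqX mulr0 addr0.
- exists m.+1; rewrite -[LHS]mul1r -e1 -hX -rmorphXn -rmorphM -mulrA.
  by rewrite rmorphM hqX mulr0.
- have yu : h (v * 'X^m) * y = 1.
    by rewrite -hX -rmorphM -mulrA -exprSr -[LHS]add0r -e0 huv.
  by have [] := mulmx1_unit yu.
Qed.

(** * Algebras of nilpotent matrices *)

Section NilAlgebra.
Variables (F : fieldType) (n p : nat) (b : 'I_p -> 'M[F]_n).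
Hypothesis b_nil : forall v : 'I_p -> F, exists m, (\sum_j v j *: b j) ^+ m = 0.
Hypothesis b_mul : forall i j, exists v : 'I_p -> F, b i *m b j = \sum_l v l *: b l.

Let stable (U : 'M[F]_n) := forall j, (U *m b j <= U)%MS.

Lemma stable_max (U W : 'M[F]_n) : stable W -> (W < U)%MS ->
  exists W', [/\ stable W', (W' < U)%MS &
    forall W2, stable W2 -> (W' <= W2)%MS -> (W2 < U)%MS -> (W2 <= W')%MS].
Proof.
have [m] := ubnP (\rank U - \rank W)%N; elim: m W => // m IHm W le_m stW ltW.
case: (classic (exists W2, [/\ stable W2, (W <= W2)%MS, (W2 < U)%MS & ~~ (W2 <= W)%MS])).
  case=> W2 [st2 le2 lt2 nle2]; apply: (IHm W2) => //.
  have: (W < W2)%MS by rewrite ltmxE le2.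
  by move/rank_ltmx; move: (rank_ltmx lt2) le_m => {IHm}; lia.
move=> no; exists W; split=> // W2 st2 le2 lt2; apply/negPn/negP => nle.
by apply: no; exists W2.
Qed.

(** The module-theoretic heart: a maximal proper stable subspace of [U]
    absorbs [U b], since otherwise some [u] in [U] outside it would satisfy
    [u = z + u a] with [a] nilpotent and [z] in the subspace, which puts
    [u = z (1 - a)^-1] into the subspace. *)
Lemma stable_descend (U : 'M[F]_n) : stable U -> U != 0 ->
  exists W, [/\ stable W, (W < U)%MS & forall j, (U *m b j <= W)%MS].
Proof.
move=> stU U0; have [||W [stW ltW maxW]] := @stable_max U 0.
- by move=> j; rewrite mul0mx sub0mx.
- by rewrite lt0mx.
exists W; split=> // j; apply/row_subP => i; rewrite row_mul; set u := row i U.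
have uU : (u <= U)%MS := row_sub i U.
apply/negPn/negP => nuW.
pose M := \matrix_l (u *m b l).
have uM l : (u *m b l <= M)%MS by rewrite -[u *m b l](rowK (fun l => u *m b l)) row_sub.
have stM : stable (W + M)%MS.
  move=> l; rewrite addsmxMr addsmx_sub (submx_trans (stW l)) ?addsmxSl //=.
  apply/row_subP => l'; rewrite row_mul rowK -mulmxA.
  have [v ->] := b_mul l' l; rewrite mulmx_sumr summx_sub // => c _.
  by rewrite -scalemxAr scalemx_sub // (submx_trans (uM c)) ?addsmxSr.
have leWM : (W + M <= U)%MS.
  rewrite addsmx_sub (ltmxW ltW); apply/row_subP => l; rewrite rowK.
  by rewrite (submx_trans _ (stU l)) // submxMr.
have UWM : (U <= W + M)%MS.
  apply/negPn/negP => nle; move/negP: nuW; apply.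
  apply: submx_trans (maxW _ stM (addsmxSl _ _) _); last by rewrite ltmxE leWM.
  by apply: submx_trans (uM j) (addsmxSr _ _).
have /sub_addsmxP[[z D] /= equ] := submx_trans uU UWM.
pose a := \sum_l D 0 l *: b l.
have ea : D *m M = u *m a.
  rewrite mulmx_sum_row mulmx_sumr; apply: eq_bigr => l _.
  by rewrite rowK -scalemxAr.
have [m am0] := b_nil (D 0); rewrite -/a in am0.
have Wa : (W *m a <= W)%MS.
  by rewrite mulmx_sumr summx_sub // => l _; rewrite -scalemxAr scalemx_sub.
have key c : (u - u *m a ^+ c <= W)%MS.
  elim: c => [|c IHc]; first by rewrite expr0 mulmx1 subrr sub0mx.
  have -> : u - u *m a ^+ c.+1 = z *m W + (u - u *m a ^+ c) *m a.
    rewrite mulmxBl -mulmxA -[_ ^+ c *m a]/(a ^+ c * a) -exprSr addrA.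
    by congr (_ - _); rewrite -ea.
  rewrite addmx_sub ?submxMl // (submx_trans _ Wa) // submxMr //.
have := key m; rewrite am0 mulmx0 subr0 => uW.
by move/negP: nuW; apply; apply: submx_trans (stW j); apply: submxMr.
Qed.

(** Descending along stable subspaces makes a nil algebra nilpotent, which turns
    nilpotency of all its elements into finitely many equations. *)
Lemma nil_words (s : seq 'I_p) :
  (n <= size s)%N -> foldr (fun j M => b j *m M) 1%:M s = 0.
Proof.
have gen (U : 'M[F]_n) : stable U -> (\rank U <= size s)%N ->
    U *m foldr (fun j M => b j *m M) 1%:M s = 0.
  elim: s U => [|j s IHs] U stU /= le_s.
    by move: le_s; rewrite leqn0 mxrank_eq0 => /eqP->; rewrite mul0mx.
  have [->|U0] := eqVneq U 0; first by rewrite mul0mx.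
  have [W [stW /rank_ltmx ltW UW]] := stable_descend stU U0.
  rewrite mulmxA; have /submxP[D ->] := UW j.
  by rewrite -mulmxA IHs ?mulmx0 // -ltnS (leq_trans ltW).
move=> le_s; rewrite -[LHS]mul1mx gen //; last by rewrite mxrank1.
by move=> j; apply: submx1.
Qed.

End NilAlgebra.

(** * Representations as systems of projections *)

Lemma idempotent_factor (F : fieldType) n (E : 'M[F]_n) : E *m E = E ->
  exists (C : 'M_(n, \rank E)) (R : 'M_(\rank E, n)), C *m R = E /\ R *m C = 1%:M.
Proof.
move=> EE; exists (col_base E), (row_base E).
by rewrite mulmx_base idempotent_base.
Qed.

Lemma rank_retract (F : fieldType) n r (C : 'M[F]_(n, r)) (R : 'M[F]_(r, n)) :
  R *m C = 1%:M -> \rank (C *m R) = r.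
Proof.
move=> RC; apply/eqP; rewrite eqn_leq (leq_trans (mxrankM_maxl _ _)) ?rank_leq_col //=.
have {1}-> : r = \rank (R *m (C *m R) *m C) by rewrite !mulmxA RC mul1mx RC mxrank1.
by rewrite (leq_trans (mxrankM_maxl _ _)) ?mxrankM_maxr.
Qed.

Lemma rank_orth_add (F : fieldType) n (E1 E2 : 'M[F]_n) :
  E1 *m E1 = E1 -> E2 *m E2 = E2 -> E1 *m E2 = 0 -> E2 *m E1 = 0 ->
  \rank (E1 + E2)%R = (\rank E1 + \rank E2)%N.
Proof.
move=> E11 E22 E12 E21; rewrite -mxrank_disjoint_sum.
  have leE : (E1 + E2 <= (E1 + E2)%R)%MS.
    rewrite addsmx_sub; apply/andP; split; apply/submxP.
      by exists E1; rewrite mulmxDr E11 E12 addr0.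
    by exists E2; rewrite mulmxDr E22 E21 add0r.
  by apply/eqP; rewrite eqn_leq !mxrankS // addmx_sub_adds.
apply/eqP/rowV0P => v; rewrite sub_capmx => /andP[/submxP[D ->]] /submxP[D' eqD].
by rewrite -E11 mulmxA eqD -mulmxA E21 mulmx0.
Qed.

Lemma horner_mx_retract (F : fieldType) n r (C : 'M[F]_(n.+1, r.+1))
    (R : 'M[F]_(r.+1, n.+1)) f p :
  R *m C = 1%:M -> f *m (C *m R) = C *m R *m f ->
  horner_mx (R *m f *m C) p = R *m horner_mx f p *m C.
Proof.
move=> RC fC; elim/poly_ind: p => [|p c IHp]; first by rewrite !rmorph0 mulmx0 mul0mx.
rewrite !rmorphD !rmorphM /= !horner_mx_X !horner_mx_C IHp mulmxDr mulmxDl.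
rewrite mul_mx_scalar -scalemxAl RC scalemx1; congr (_ + _).
rewrite -[LHS]/(_ *m _) -[_ * f]/(_ *m f) !mulmxA.
rewrite -(mulmxA (R *m _) C) -(mulmxA (R *m _) (C *m R)) -fC.
by rewrite -!mulmxA RC mulmx1 .
Qed.

Section MxRep.
Variables (k : fieldType) (V A : finType).

(** A representation on one row space [k^n]: the [e i] are the projections
    onto the spaces at the vertices, and each arrow acts from the right. *)
Definition is_mxrep n (h t : A -> V) (e : V -> 'M[k]_n) (x : A -> 'M[k]_n) :=
  (forall i j, e i *m e j = if i == j then e i else 0) /\
  (forall a, e (t a) *m x a *m e (h a) = x a).

Definition mxendo n (e : V -> 'M[k]_n) (x : A -> 'M[k]_n) (f : 'M[k]_n) :=
  [/\ f *m \sum_i e i = f, forall i, f *m e i = e i *m f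
    & forall a, f *m x a = x a *m f].

(** Indecomposability through idempotent endomorphisms. The unit is the sum of
    the [e i] rather than [1%:M]: this leaves room for block matrices whose
    corners are larger than the spaces they carry. *)
Definition mxindec n (e : V -> 'M[k]_n) (x : A -> 'M[k]_n) :=
  forall f, mxendo e x f -> f *m f = f -> f = 0 \/ f = \sum_i e i.

Definition primitive_dim (d : V -> nat) :=
  forall m, (forall i, (m %| d i)%N) -> m = 1%N.

Section Basics.
Variables (n : nat) (h t : A -> V) (e : V -> 'M[k]_n) (x : A -> 'M[k]_n).
Hypothesis repx : is_mxrep h t e x.

Lemma mxrep_idem i : e i *m e i = e i.
Proof. by rewrite repx.1 eqxx. Qed.

Lemma mxrep_orth i j : i != j -> e i *m e j = 0.
Proof. by rewrite repx.1 => /negPf->. Qed.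

Lemma mxrep_suml i : e i *m \sum_j e j = e i.
Proof.
rewrite mulmx_sumr (bigD1 i) //= mxrep_idem big1 ?addr0 // => j ne.
by rewrite mxrep_orth // eq_sym.
Qed.

Lemma mxrep_sumr i : (\sum_j e j) *m e i = e i.
Proof.
rewrite mulmx_suml (bigD1 i) //= mxrep_idem big1 ?addr0 // => j ne.
by rewrite mxrep_orth.
Qed.

Lemma mxrep_sum_idem : (\sum_j e j) *m (\sum_j e j) = \sum_j e j.
Proof. by rewrite mulmx_suml; apply: eq_bigr => i _; rewrite mxrep_suml. Qed.

Lemma mxrep_tail a : e (t a) *m x a = x a.
Proof. by rewrite -repx.2 !mulmxA mxrep_idem. Qed.

Lemma mxrep_head a : x a *m e (h a) = x a.
Proof. by rewrite -repx.2 -!mulmxA mxrep_idem. Qed.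

Lemma mxrep_tail0 a i : i != t a -> e i *m x a = 0.
Proof. by move=> ne; rewrite -mxrep_tail mulmxA mxrep_orth // mul0mx. Qed.

Lemma mxrep_head0 a i : i != h a -> x a *m e i = 0.
Proof. by move=> ne; rewrite -mxrep_head -mulmxA mxrep_orth 1?eq_sym // mulmx0. Qed.

(** Counting and specializing need the [e i] to add up to the identity. *)
Lemma mxrep_compress : mxindec e x ->
  exists n' (e' : V -> 'M[k]_n') (x' : A -> 'M[k]_n'),
    [/\ is_mxrep h t e' x', mxindec e' x', \sum_i e' i = 1%:M
      & forall i, \rank (e' i) = \rank (e i)].
Proof.
move=> ind; have [C [R [CR RC]]] := idempotent_factor mxrep_sum_idem.
set E := \sum_i e i in C R CR RC; move: (\rank E) C R CR RC => r C R CR RC; pose e' i :=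
  R *m e i *m C; pose x' a := R *m x a *m C.
have CRe i : C *m R *m e i = e i by rewrite CR mxrep_sumr.
have eCR i : e i *m (C *m R) = e i by rewrite CR mxrep_suml.
have CRx a : C *m R *m x a = x a by rewrite -mxrep_tail mulmxA CRe.
have xCR a : x a *m (C *m R) = x a by rewrite -mxrep_head -mulmxA eCR.
have mulRC (y z : 'M_n) : y *m (C *m R) = y -> (R *m y *m C) *m (R *m z *m C) = R *m (y
  *m z) *m C.
  by move=> yCR; rewrite -{2}yCR !mulmxA.
have Ce i : C *m e' i *m R = e i by rewrite /e' !mulmxA CRe -mulmxA eCR.
have Cx a : C *m x' a *m R = x a by rewrite /x' !mulmxA CRx -mulmxA xCR.
have Re i : R *m e i = e' i *m R by rewrite /e' -(mulmxA _ C) -(mulmxA _ (e i)) eCR.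
have eC i : e i *m C = C *m e' i by rewrite /e' !mulmxA CRe.
have Rx a : R *m x a = x' a *m R by rewrite /x' -(mulmxA _ C) -(mulmxA _ (x a)) xCR.
have xC a : x a *m C = C *m x' a by rewrite /x' !mulmxA CRx.
have sum1 : \sum_i e' i = 1%:M.
  by rewrite -mulmx_suml -mulmx_sumr -/E -CR !mulmxA RC mul1mx.
have rep' : is_mxrep h t e' x'.
  split=> [i j|a]; first by rewrite mulRC // repx.1; case: eqP => // _; rewrite mulmx0
    mul0mx.
  by rewrite !mulRC ?repx.2 // -mulmxA xCR.
have rk i : \rank (e' i) = \rank (e i).
  apply/eqP; rewrite eqn_leq {1}/e' -{3}(Ce i).
  rewrite (leq_trans (mxrankM_maxl _ _)) ?mxrankM_maxr //=.
  by rewrite (leq_trans (mxrankM_maxl _ _)) ?mxrankM_maxr.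
exists r, e', x'; split=> //; move: e' x' rep' sum1 Re eC Rx xC {mulRC Ce Cx rk}.
move=> e' x' rep' sum1 Re eC Rx xC f [fE fe fx] ff.
have [||f0|f1] := ind (C *m f *m R).
- split=> [|i|a].
  + by rewrite -/E -CR -mulmxA (mulmxA R) RC mul1mx.
  + by rewrite -mulmxA Re !mulmxA eC -(mulmxA C f) fe mulmxA.
  + by rewrite -mulmxA Rx !mulmxA xC -(mulmxA C f) fx mulmxA.
- by rewrite !mulmxA -(mulmxA (C *m f) R) RC mulmx1 -(mulmxA C f) ff.
- left; have := congr1 (fun y => R *m y *m C) f0.
  by rewrite /= !mulmxA RC mul1mx -mulmxA RC mulmx1 mulmx0 mul0mx.
- right; rewrite sum1; have := congr1 (fun y => R *m y *m C) f1.
  by rewrite /= !mulmxA RC mul1mx -mulmxA RC mulmx1 -/E -CR mulmxA RC mul1mx RC.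
Qed.

End Basics.

Lemma mxrep_dim_gt0 n (e : V -> 'M[k]_n) :
  primitive_dim (fun i => \rank (e i)) -> (0 < n)%N.
Proof.
case: n e => // e prim; have /prim // : forall i, (2 %| \rank (e i))%N.
by move=> i; rewrite (_ : \rank _ = 0%N) //; apply/eqP; rewrite -leqn0 rank_leq_row.
Qed.

(** Fitting's lemma makes the minimal polynomial of an endomorphism [f] a power
    of an irreducible [r]; then [deg r] divides every [\rank (e i)], so that [r]
    is linear. In particular indecomposability survives extension of scalars. *)
Lemma mxindec_scalar_nilp n (h t : A -> V) (e : V -> 'M[k]_n) (x : A -> 'M[k]_n) f :
  is_mxrep h t e x -> mxindec e x -> \sum_i e i = 1%:M ->
  primitive_dim (fun i => \rank (e i)) -> mxendo e x f ->
  exists c m, (f - c%:M) ^+ m = 0.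
Proof.
move=> repx ind sum1 prim [_ fe fx].
have := mxrep_dim_gt0 prim.
case: n e x f repx ind sum1 prim fe fx => // n e x f repx ind sum1 prim fe fx _.
have [r irr_r rp] : exists2 r, irreducible_poly r & r %| mxminpoly f.
  by apply: irreducible_factor; rewrite size_mxminpoly ltnS mxminpoly_nonconstant.
have [w [idem w1 w0]] := fitting_idempotent (horner_mx f r).
set u := horner_mx _ w in idem w1 w0.
have comu y : f *m y = y *m f -> u *m y = y *m u.
  by move=> fy; apply/comm_mx_sym/comm_mx_horner/comm_mx_horner/comm_mx_sym.
have [m rm0] : exists m, horner_mx f (r ^+ m) = 0.
  have [||u0|u1] := ind u.
  - by split=> [|i|a]; rewrite ?sum1 ?mulmx1 // comu.
  - exact: idem.
  - have /dvdpP[q eq_p] := rp; have := mx_root_minpoly f.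
    rewrite eq_p rmorphM => /(congr1 (fun y => y *m invmx (horner_mx f r))).
    rewrite -[X in X *m _]/(horner_mx f q *m horner_mx f r) mulmxK ?w0 // mul0mx => q0.
    have := mxminpoly_min q0 => /dvdp_leq.
    have p0 : mxminpoly f != 0 by rewrite monic_neq0 ?mxminpoly_monic.
    have q_neq0 : q != 0 by apply: contraNneq p0; rewrite eq_p => ->; rewrite mul0r.
    have := irr_r.1 => sr.
    rewrite q_neq0 eq_p size_mul ?(irredp_neq0 irr_r) // => /(_ isT).
    by move: sr q_neq0; rewrite -size_poly_gt0; lia.
  - have [|m rm] := w1; first by rewrite u1 sum1.
    by exists m; rewrite rmorphXn.
have sr2 : size r = 2.
  suff : ((size r).-1 = 1)%N by have := irr_r.1; lia.
  apply: prim => i; have [C [R [CR RC]]] := idempotent_factor (mxrep_idem repx i).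
  move: (\rank (e i)) C R CR RC => [|d] // C R CR RC.
  apply: (@irreducible_size_dvd _ _ (R *m f *m C) r m) => //.
  by rewrite horner_mx_retract ?CR // rm0 mulmx0 mul0mx.
have [c rc] : exists c, r %= 'X - c%:P.
  exists (- r`_0 / r`_1); have r10 : r`_1 != 0.
    by have := lead_coef_eq0 r; rewrite /lead_coef sr2 /= => ->; apply: irredp_neq0.
  apply/eqpP; exists (1, r`_1); rewrite /= ?oner_neq0 ?r10 // scale1r.
  apply/polyP => j; rewrite coefZ coefB coefX coefC.
  case: j => [|[|j]] /=; rewrite ?subr0 ?mulr1 ?mulr0 //.
    by rewrite sub0r mulNr opprK mulrC divfK.
  by rewrite nth_default // sr2.
exists c, m; have : horner_mx f (('X - c%:P) ^+ m) = 0.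
  have /andP[+ _] : r ^+ m %= ('X - c%:P) ^+ m by rewrite eqp_exp.
  by case/dvdpP => q2 ->; rewrite rmorphM /= rm0 mulr0.
by rewrite rmorphXn rmorphB /= horner_mx_X horner_mx_C.
Qed.

End MxRep.

(** * Reduction to a finite field *)

Definition commutator_mx (R : comNzRingType) n (y : 'M[R]_n) : 'M[R]_(n * n) :=
  lin_mulmxr y - lin_mulmx y.

Lemma mul_commutator_mx (R : comNzRingType) n (f y : 'M[R]_n) :
  mxvec f *m commutator_mx y = mxvec (f *m y - y *m f).
Proof. by rewrite mulmxBr !mul_vec_lin /= linearB. Qed.

Lemma map_commutator_mx (R S : comNzRingType) (g : {rmorphism R -> S}) n (y : 'M[R]_n) :
  map_mx g (commutator_mx y) = commutator_mx (map_mx g y).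
Proof.
by rewrite /commutator_mx map_mxB; congr (_ - _); apply: map_lin_mx => M; rewrite map_mxM.
Qed.

(** The common centralizer of the [y j] is cut out by equations: the rows of
    [K] span it, and the identity expresses this without any rank condition. *)
Lemma centralizer_certificate (F : fieldType) n m (y : 'I_m -> 'M[F]_n) :
  exists (K W : 'M[F]_(n * n)) (U : 'I_m -> 'M[F]_(n * n)),
    1%:M = \sum_j commutator_mx (y j) *m U j + W *m K /\
    (forall j, K *m commutator_mx (y j) = 0).
Proof.
pose T := \mxrow_(j < m) commutator_mx (y j).
have TP p (u : 'M_(p, n * n)) : u *m T = 0 -> forall j, u *m commutator_mx (y j) = 0.
  rewrite mul_mxrow => uT j.
  by have := congr1 (fun M => submxrow M j) uT; rewrite mxrowK submxrow0.
have /sub_kermxP : (1%:M - T *m pinvmx T) *m T = 0.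
  by rewrite mulmxBl mul1mx mulmxKpV ?subrr ?submx_refl.
case/submxP => W eqW; exists (kermx T), W, (fun j => submxcol (pinvmx T) j).
split; last by move=> j; apply: TP; apply: mulmx_ker.
by rewrite -eqW -mul_mxrow_mxcol submxcolK addrC subrK.
Qed.

(** Converse of [nil_words], by expanding the power of a sum. *)
Lemma expr_words (F : fieldType) n p (b : 'I_p -> 'M[F]_n) (v : 'I_p -> F) m (M : 'M[F]_n) :
  (forall s : seq 'I_p, size s = m -> foldr (fun j => mulmx (b j)) M s = 0) ->
  (\sum_j v j *: b j) ^+ m *m M = 0.
Proof.
elim: m M => [|m IHm] M words; first by rewrite mul1mx; apply: (words [::]).
rewrite exprSr -[_ * _]/(_ *m _) -mulmxA mulmx_suml mulmx_sumr big1 // => j _.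
rewrite -scalemxAl -scalemxAr IHm ?scaler0 // => s ss.
by rewrite -foldr_rcons words // size_rcons ss.
Qed.

Lemma idempotent_scalar_nilp (F : fieldType) n (f : 'M[F]_n) c m :
  f *m f = f -> (f - c%:M) ^+ m = 0 -> f = 0 \/ f = 1%:M.
Proof.
move=> ff nil.
have f1 j : f *m (f - c%:M) ^+ j = (1 - c) ^+ j *: f.
  elim: j => [|j IHj]; first by rewrite mulmx1 scale1r.
  rewrite exprSr -[_ ^+ j * _]/(_ *m _) mulmxA IHj -scalemxAl mulmxBr ff mul_mx_scalar.
  by rewrite -{1}[f]scale1r -scalerBl scalerA exprSr.
have f0 j : (1%:M - f) *m (f - c%:M) ^+ j = (- c) ^+ j *: (1%:M - f).
  elim: j => [|j IHj]; first by rewrite mulmx1 scale1r.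
  rewrite exprSr -[_ ^+ j * _]/(_ *m _) mulmxA IHj -scalemxAl mulmxBr mulmxBl mul1mx ff
    subrr.
  by rewrite mul_mx_scalar sub0r -scaleNr scalerA exprSr.
have := f0 m; have := f1 m; rewrite nil !mulmx0 => /esym/eqP.
rewrite scaler_eq0 expf_eq0 => /orP[/andP[_ /eqP c1] | /eqP -> _]; last by left.
move/esym/eqP; rewrite scaler_eq0 expf_eq0 => /orP[/andP[_ c0] | ].
  by move: c1; rewrite -[1 - c]/(1 + - c) (eqP c0) addr0 => /eqP; rewrite oner_eq0.
by rewrite subr_eq0 => /eqP <-; right.
Qed.

Section ScalarNilp.
Variables (k : fieldType) (V A : finType) (n : nat) (h t : A -> V).
Variables (e : V -> 'M[k]_n) (x : A -> 'M[k]_n).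

Lemma mxendo_mul f g : mxendo e x f -> mxendo e x g -> mxendo e x (f *m g).
Proof.
case=> fE fe fx [gE ge gx]; split=> [|i|a]; first by rewrite -mulmxA gE.
- by rewrite -mulmxA ge mulmxA fe mulmxA.
- by rewrite -mulmxA gx mulmxA fx mulmxA.
Qed.

Hypothesis scalar_nilp : forall f, mxendo e x f -> exists c m, (f - c%:M) ^+ m = 0.
Hypothesis sum1 : \sum_i e i = 1%:M.

Lemma mxendo_scalar c : mxendo e x c%:M.
Proof.
by split=> [|i|a]; rewrite ?sum1 ?mulmx1 // mul_mx_scalar mul_scalar_mx.
Qed.

Lemma mxendoD f g : mxendo e x f -> mxendo e x g -> mxendo e x (f + g).
Proof.
case=> fE fe fx [gE ge gx]; split=> [|i|a]; first by rewrite mulmxDl fE gE.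
- by rewrite mulmxDl fe ge mulmxDr.
- by rewrite mulmxDl fx gx mulmxDr.
Qed.

Lemma mxendoN f : mxendo e x f -> mxendo e x (- f).
Proof.
case=> fE fe fx; split=> [|i|a]; first by rewrite mulNmx fE.
- by rewrite mulNmx fe mulmxN.
- by rewrite mulNmx fx mulmxN.
Qed.

Lemma mxendo_inv f : mxendo e x f -> f \in unitmx -> mxendo e x (invmx f).
Proof.
case=> fE fe fx fu; split=> [|i|a]; first by rewrite sum1 mulmx1.
- by apply: (can_inj (mulKmx fu)); rewrite mulKVmx // mulmxA fe mulmxK.
- by apply: (can_inj (mulKmx fu)); rewrite mulKVmx // mulmxA fx mulmxK.
Qed.

Lemma mxendo_nilp_det0 f : mxendo e x f -> \det f = 0 -> exists m, f ^+ m = 0.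
Proof.
move=> /scalar_nilp[c [m nil]]; rewrite (det_scalar_nilp nil) => /eqP.
rewrite expf_eq0 => /andP[_ /eqP c0]; exists m.
by move: nil; rewrite c0 raddf0 subr0.
Qed.

(** Locality of the endomorphism ring: if [w = f + g] were invertible, then
    [w^-1 f] and [w^-1 g] would be nilpotent with sum [1]. *)
Lemma mxendo_singularD f g : mxendo e x f -> mxendo e x g ->
  \det f = 0 -> \det g = 0 -> \det (f + g) = 0.
Proof.
move=> ef eg f0 g0; apply/eqP/negPn/negP => det_w.
have uw : f + g \in unitmx by rewrite unitmxE unitfE.
have ew := mxendo_inv (mxendoD ef eg) uw.
have [|m nil] := mxendo_nilp_det0 (mxendo_mul ew ef); first by rewrite det_mulmx f0 mulr0.
have : (- (invmx (f + g) *m g - 1%:M)) ^+ m = 0.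
  by rewrite -(mulVmx uw) mulmxDr opprB addrK.
rewrite -mulN1r exprMn_comm; last by apply/commr_sym/commrN1.
rewrite -signr_odd => nil'; have {}nil' : (invmx (f + g) *m g - 1%:M) ^+ m = 0.
  case: (odd m) nil'; rewrite ?expr1 ?expr0 ?mul1r // mulN1r.
  by move/eqP; rewrite oppr_eq0 => /eqP.
have := det_scalar_nilp nil'; rewrite det_mulmx g0 mulr0 expr1n => /eqP.
by rewrite eq_sym oner_eq0.
Qed.

End ScalarNilp.

(** Everything that makes a representation indecomposable with scalar residue
    field, stated as polynomial identities between finitely many scalars. *)
Lemma mxindec_certificate (k : fieldType) (V A : finType) n (h t : A -> V)
    (e : V -> 'M[k]_n) (x : A -> 'M[k]_n) m (y : 'I_m -> 'M[k]_n) :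
  is_mxrep h t e x -> mxindec e x -> \sum_i e i = 1%:M ->
  primitive_dim (fun i => \rank (e i)) ->
  (forall f, (forall j, f *m y j = y j *m f) <-> mxendo e x f) ->
  exists (K W : 'M[k]_(n * n)) (U : 'I_m -> 'M[k]_(n * n)) (c : 'I_(n * n) -> k),
    1%:M = \sum_j commutator_mx (y j) *m U j + W *m K /\
    forall s : seq 'I_(n * n), size s = n ->
      foldr (fun l => mulmx (vec_mx (row l K) - (c l)%:M)) 1%:M s = 0.
Proof.
move=> repx ind sum1 prim yP; have n0 := mxrep_dim_gt0 prim.
have [K [W [U [eq1 KT]]]] := centralizer_certificate y.
have nilp f (ef : mxendo e x f) := mxindec_scalar_nilp repx ind sum1 prim ef.
pose f l := vec_mx (row l K).
have ef l : mxendo e x (f l).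
  apply/yP => j; have := congr1 (row l) (KT j).
  rewrite row_mul -[row l K]vec_mxK mul_commutator_mx row0 => /eqP.
  by rewrite mxvec_eq0 subr_eq0 => /eqP.
have span g : mxendo e x g -> exists v : 'I_(n * n) -> k, g = \sum_l v l *: f l.
  move=> eg; exists (fun l => (mxvec g *m W) 0 l); apply: (can_inj mxvecK).
  rewrite -[LHS]mulmx1 eq1 mulmxDr mulmx_sumr big1 ?add0r => [|j _]; last first.
    by rewrite mulmxA mul_commutator_mx ((yP g).2 eg) subrr linear0 mul0mx.
  rewrite mulmxA mulmx_sum_row linear_sum; apply: eq_bigr => l _.
  by rewrite linearZ /= vec_mxK.
have [c cP] := fin_all_exists (fun l => nilp _ (ef l)).
exists K, W, U, c; split=> // s ss.
pose b l := f l - (c l)%:M.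
(* The singular endomorphisms form the nilpotent radical, spanned by the [b l]. *)
pose sing g := mxendo e x g /\ \det g = 0.
have sing_b l : sing (b l).
  split; first by apply: mxendoD (ef l) (mxendoN (mxendo_scalar x sum1 _)).
  have [r br0] := cP l; rewrite (@det_scalar_nilp _ _ (b l) 0 r) ?expr0n ?eqn0Ngt ?n0 //.
  by rewrite raddf0 subr0.
have singZ a g : sing g -> sing (a *: g).
  case=> [[gE ge gx] g0]; split; last by rewrite detZ g0 mulr0.
  by split=> [|i|a']; rewrite -scalemxAl ?gE // ?ge ?gx -scalemxAr.
have singD g g' : sing g -> sing g' -> sing (g + g').
  case=> eg g0 [eg' g0']; split; first exact: mxendoD.
  exact: (mxendo_singularD nilp sum1).
have sing0 : sing 0 by rewrite -(scale0r (b (Ordinal (leq_mul n0 n0)))); apply: singZ.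
have sing_sum (v : 'I_(n * n) -> k) : sing (\sum_l v l *: b l).
  by apply: (big_ind sing) => // l _; apply: singZ.
apply: (@nil_words _ _ _ b); last by rewrite ss.
  by move=> v; have [ev v0] := sing_sum v; apply: (mxendo_nilp_det0 nilp ev v0).
move=> i j; have [v eqv] := span _ (mxendo_mul (sing_b i).1 (sing_b j).1).
exists v; have eqc : b i *m b j - \sum_l v l *: b l = (\sum_l v l * c l)%:M.
  rewrite eqv -sumrB raddf_sum /=; apply: eq_bigr => l _.
  by rewrite -scalerBr /b opprB addrC subrK scale_scalar_mx.
have : sing (b i *m b j - \sum_l v l *: b l).
  apply: singD; last by rewrite -scaleN1r; apply: singZ.
  split; first exact: mxendo_mul (sing_b i).1 (sing_b j).1.
  by rewrite det_mulmx (sing_b i).2 mul0r.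
rewrite eqc => -[_ /eqP]; rewrite det_scalar expf_eq0 n0 => /eqP c0.
by apply/eqP; rewrite -subr_eq0 eqc c0 raddf0.
Qed.

Lemma finField_primitive_root (F : finFieldType) l : prime l -> l%:R != 0 :> F ->
  exists (L : finFieldType) (j : {rmorphism F -> L}) (z : L), l.-primitive_root z.
Proof.
move=> pr_l l0; have l_gt1 := prime_gt1 pr_l.
have sp : size (\poly_(i < l) (1 : F)) = l by rewrite size_poly_eq // oner_neq0.
have [|L [j [z]]] := @finField_root F (\poly_(i < l) 1); first by rewrite sp.
rewrite /root poly_def rmorph_sum horner_sum.
under eq_bigr do rewrite scale1r rmorphXn /= map_polyX hornerXn.
move=> /eqP z_sum; exists L, j, z.
have zl : z ^+ l = 1 by apply/eqP; rewrite -subr_eq0 subrX1 z_sum mulr0.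
have [m pz dvd_m] := prim_order_exists (prime_gt0 pr_l) zl.
have /orP[/eqP m1|/eqP <- //] := (primeP pr_l).2 _ dvd_m.
have z1 : z = 1 by have := prim_expr_order pz; rewrite m1.
have /eqP : j l%:R = 0.
  rewrite rmorph_nat -[RHS]z_sum z1.
  by under eq_bigr do rewrite expr1n; rewrite sumr_const card_ord.
by rewrite fmorph_eq0 (negPf l0).
Qed.

Definition mx_entries (R : Type) m n (M : 'M[R]_(m, n)) : seq R :=
  [seq M p.1 p.2 | p <- enum {: 'I_m * 'I_n}].

Lemma mem_mx_entries (R : eqType) m n (M : 'M[R]_(m, n)) i j : M i j \in mx_entries M.
Proof. by apply/mapP; exists (i, j); rewrite ?mem_enum. Qed.

Lemma map_mx_lift (B R : nzRingType) (eps : B -> R) (lift : R -> B) (xs : seq R)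
    m n (M : 'M[R]_(m, n)) :
  {in xs, cancel lift eps} -> {subset mx_entries M <= xs} ->
  map_mx eps (map_mx lift M) = M.
Proof.
by move=> liftK sub; apply/matrixP => i j; rewrite !mxE liftK // sub // mem_mx_entries.
Qed.

Lemma mem_flatten_enum (T : eqType) (I : finType) (g : I -> seq T) i :
  {subset g i <= flatten [seq g i | i <- enum I]}.
Proof. by move=> y yg; apply/flattenP; exists (g i); rewrite ?map_f ?mem_enum. Qed.

Lemma map_foldr_mulmx (R S : comNzRingType) (g : {rmorphism R -> S}) n p
    (b : 'I_p -> 'M[R]_n) s :
  map_mx g (foldr (fun l => mulmx (b l)) 1%:M s) =
  foldr (fun l => mulmx (map_mx g (b l))) 1%:M s.
Proof. by elim: s => [|l s IHs] /=; rewrite ?map_mx1 // map_mxM IHs. Qed.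

(** Specializing the entries of a certificate of [mxindec_certificate] yields a
    representation over a finite field whose endomorphisms are still scalars
    plus nilpotents. The root of unity can be adjoined because the certificate
    survives further extensions. *)
Theorem mxrep_specialize (k : fieldType) (V A : finType) n (h t : A -> V)
    (e : V -> 'M[k]_n) (x : A -> 'M[k]_n) (l : nat) :
  is_mxrep h t e x -> mxindec e x -> \sum_i e i = 1%:M ->
  primitive_dim (fun i => \rank (e i)) -> prime l -> l%:R != 0 :> k ->
  exists (F : finFieldType) (e' : V -> 'M[F]_n) (x' : A -> 'M[F]_n),
    [/\ is_mxrep h t e' x', mxindec e' x', \sum_i e' i = 1%:M,
        forall i, \rank (e' i) = \rank (e i)
      & exists z : F, l.-primitive_root z].
Proof.
move=> repx ind sum1 prim pr_l l0.
pose y (j : 'I_#|{: V + A}|) :=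
  match enum_val j with inl i => e i | inr a => x a end.
have yP f : (forall j, f *m y j = y j *m f) <-> mxendo e x f.
  split=> [fy | [_ fe fx] j]; last by rewrite /y; case: (enum_val j).
  split=> [|i|a]; first by rewrite sum1 mulmx1.
    by have := fy (enum_rank (inl i)); rewrite /y enum_rankK.
  by have := fy (enum_rank (inr a)); rewrite /y enum_rankK.
have [K [W [U [c [eq1 words]]]]] := mxindec_certificate repx ind sum1 prim yP.
pose g1 i := mx_entries (e i) ++ mx_entries (col_base (e i)) ++ mx_entries (row_base (e i)).
pose xs := flatten [seq g1 i | i <- enum V] ++ flatten [seq mx_entries (x a) | a <- enum A]
  ++ flatten [seq mx_entries (U j) | j <- enum 'I_#|{: V + A}|]
  ++ mx_entries K ++ mx_entries W ++ [seq c j | j <- enum 'I_(n * n)] ++ [:: l%:R^-1].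
have [B [eps [lift [goodB liftK]]]] := specialize_seq xs.
have [|F0 [phi0 [_ ker0]]] := goodB _ eps 1; first by rewrite rmorph1 oner_neq0.
have l_in : eps (lift l%:R^-1) = l%:R^-1.
  by apply: liftK; rewrite !mem_cat inE eqxx !orbT.
have [|F [j0 [z pz]]] := finField_primitive_root (F := F0) pr_l.
  have : phi0 (l%:R * lift l%:R^-1 - 1) = 0.
    by apply: ker0; rewrite rmorphB rmorphM rmorph_nat rmorph1 l_in divff ?subrr.
  rewrite rmorphB rmorphM rmorph_nat rmorph1 => /eqP; rewrite subr_eq0 => /eqP e1.
  by apply/eqP => l00; move: e1; rewrite l00 mul0r => /esym/eqP; rewrite oner_eq0.
pose psi : {rmorphism B -> F} := j0 \o phi0.
have ker b : eps b = 0 -> psi b = 0 by move/ker0; rewrite /psi /= => ->; rewrite rmorph0.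
move: psi ker => psi ker.
have transfer m1 m2 (P Q : 'M[B]_(m1, m2)) : map_mx eps P = map_mx eps Q ->
    map_mx psi P = map_mx psi Q.
  move=> eqPQ; apply/matrixP => u v; rewrite !mxE; apply/eqP; rewrite -subr_eq0 -rmorphB.
  apply/eqP/ker; rewrite rmorphB; move/matrixP/(_ u v): eqPQ; rewrite !mxE => ->.
  by rewrite subrr.
pose L m1 m2 (M : 'M[k]_(m1, m2)) := map_mx lift M.
pose S m1 m2 (M : 'M[k]_(m1, m2)) : 'M[F]_(m1, m2) := map_mx psi (L m1 m2 M).
have LK m1 m2 (M : 'M[k]_(m1, m2)) : {subset mx_entries M <= xs} -> map_mx eps (L _ _ M)
  = M.
  exact: map_mx_lift.
have inx i : {subset g1 i <= xs}.
  by move=> u ug; rewrite mem_cat (mem_flatten_enum (i := i)).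
have Le i : map_mx eps (L _ _ (e i)) = e i.
  by apply: LK => u ug; apply: (inx i); rewrite mem_cat ug.
have LC i : map_mx eps (L _ _ (col_base (e i))) = col_base (e i).
  by apply: LK => u ug; apply: (inx i); rewrite !mem_cat ug orbT.
have LR i : map_mx eps (L _ _ (row_base (e i))) = row_base (e i).
  by apply: LK => u ug; apply: (inx i); rewrite !mem_cat ug !orbT.
have Lx a : map_mx eps (L _ _ (x a)) = x a.
  by apply: LK => u ug; rewrite 2!mem_cat (mem_flatten_enum (g := fun a => mx_entries (x
    a)) (i := a)) ?orbT.
have LU j : map_mx eps (L _ _ (U j)) = U j.
  by apply: LK => u ug; rewrite 3!mem_cat (mem_flatten_enum (g := fun j => mx_entries (U
    j)) (i := j)) ?orbT.
have LKm : map_mx eps (L _ _ K) = K by apply: LK => u ug; rewrite !mem_cat ug !orbT.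
have LW : map_mx eps (L _ _ W) = W by apply: LK => u ug; rewrite !mem_cat ug !orbT.
have Lc j : eps (lift (c j)) = c j.
  by apply: liftK; rewrite !mem_cat (map_f c) ?mem_enum ?orbT.
exists F, (fun i => S _ _ (e i)), (fun a => S _ _ (x a)).
have sum1' : \sum_i S _ _ (e i) = 1%:M.
  rewrite -raddf_sum -(map_mx1 psi); apply: transfer.
  by rewrite raddf_sum /= map_mx1 -sum1; apply: eq_bigr => i _; apply: Le.
split=> // [||i|]; last by exists z.
- split=> [i j|a]; rewrite /S -!map_mxM.
    case: eqP => [<-|/eqP ne].
      by apply: transfer; rewrite map_mxM !Le (mxrep_idem repx).
    by rewrite -(map_mx0 psi); apply: transfer; rewrite map_mxM !Le map_mx0 (mxrep_orth
      repx).
  by apply: transfer; rewrite !map_mxM !Le !Lx repx.2.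
- move=> f [_ fe fx] ff; rewrite sum1'.
  have fy j : f *m S _ _ (y j) = S _ _ (y j) *m f by rewrite /y; case: (enum_val j).
  pose b l := vec_mx (row l (S _ _ K)) - (psi (lift (c l)))%:M.
  have Ly j : map_mx eps (L _ _ (y j)) = y j by rewrite /y; case: (enum_val j).
  have eq1' : 1%:M = \sum_j commutator_mx (S _ _ (y j)) *m S _ _ (U j) + S _ _ W *m S _ _ K.
    under eq_bigr do rewrite -map_commutator_mx -map_mxM.
    rewrite -raddf_sum -map_mxM -map_mxD -(map_mx1 psi); apply: transfer.
    rewrite map_mx1 map_mxD raddf_sum map_mxM LKm LW /= eq1; congr (_ + _).
    by apply: eq_bigr => j _; rewrite map_mxM map_commutator_mx LU Ly.
  have words' s : size s = n -> foldr (fun l => mulmx (b l)) 1%:M s = 0.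
    move=> ss; pose bB l := vec_mx (row l (L _ _ K)) - (lift (c l))%:M.
    have bE (D : comNzRingType) (g : {rmorphism B -> D}) l1 :
        map_mx g (bB l1) = vec_mx (row l1 (map_mx g (L _ _ K))) - (g (lift (c l1)))%:M.
      by rewrite map_mxB map_vec_mx map_row map_scalar_mx.
    have -> : foldr (fun l => mulmx (b l)) 1%:M s =
              map_mx psi (foldr (fun l => mulmx (bB l)) 1%:M s).
      by rewrite map_foldr_mulmx; elim: s {ss} => //= l1 s ->; rewrite bE.
    rewrite -(map_mx0 psi); apply: transfer; rewrite map_mx0 map_foldr_mulmx -[RHS](words
      s ss).
    by elim: s {ss} => //= l1 s ->; rewrite bE LKm Lc.
  pose v l := (mxvec f *m S _ _ W) 0 l.
  have eqf : f = \sum_l v l *: b l + (\sum_l v l * psi (lift (c l)))%:M.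
    rewrite raddf_sum -big_split /=; apply: (can_inj mxvecK); rewrite -[LHS]mulmx1 eq1'.
    rewrite mulmxDr mulmx_sumr big1 ?add0r => [|j _]; last first.
      by rewrite mulmxA mul_commutator_mx fy subrr linear0 mul0mx.
    rewrite mulmxA mulmx_sum_row linear_sum; apply: eq_bigr => l1 _.
    rewrite -scale_scalar_mx -scalerDr subrK linearZ /= vec_mxK //.
  apply: (idempotent_scalar_nilp (c := \sum_l v l * psi (lift (c l))) (m := n) ff).
  by rewrite {1}eqf addrK -[LHS]mulmx1; apply: expr_words.
- have eCR : S _ _ (col_base (e i)) *m S _ _ (row_base (e i)) = S _ _ (e i).
    by rewrite /S -map_mxM; apply: transfer; rewrite map_mxM LC LR Le mulmx_base.
  rewrite -eCR rank_retract // /S -map_mxM -(map_mx1 psi); apply: transfer.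
  by rewrite map_mxM LC LR map_mx1 idempotent_base // (mxrep_idem repx).
Qed.

(** * Independence of the orientation *)

Section TraceDuality.
Variables (F : finFieldType).

Lemma card_left_kernel m (P : 'M[F]_m) :
  #|[set v : 'rV[F]_m | v *m P == 0]| = (#|F| ^ (m - \rank P))%N.
Proof.
rewrite -mxrank_ker -[X in (_ ^ X)%N]mul1n -card_mx -cardsT.
rewrite -(card_imset _ (row_free_inj (row_base_free (kermx P)))).
apply: eq_card => v; rewrite inE.
rewrite -[_ == 0]/(v *m P == 0) (sameP eqP sub_kermxP) -(eq_row_base (kermx P)).
by apply/submxP/imsetP => [[D ->]|[D _ ->]]; exists D; rewrite ?inE.
Qed.

Lemma mxtrace_mxvec n (x y : 'M[F]_n) : \tr (x *m y) = (mxvec x *m (mxvec y^T)^T) 0 0.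
Proof.
rewrite /mxtrace; under eq_bigr do rewrite mxE; rewrite pair_bigA [RHS]mxE /=.
rewrite (reindex _ (curry_mxvec_bij _ _)); apply: eq_bigr => [[i j]] _ /=.
by rewrite mxvecE mxE mxvecE mxE.
Qed.

Lemma col_eq0 m (c : 'cV[F]_m) : (forall u : 'rV_m, (u *m c) 0 0 = 0) -> c = 0.
Proof. by move=> c0; apply/colP => i; have := c0 (delta_mx 0 i); rewrite -rowE !mxE. Qed.

Lemma card_kernel_adjoint n (phi psi : {linear 'M[F]_n -> 'M[F]_n}) :
  (forall x y, \tr (phi x *m y) = \tr (x *m psi y)) ->
  #|[set y | phi y == 0]| = #|[set y | psi y == 0]|.
Proof.
move=> adj; pose P := lin_mx phi.
have -> : #|[set y | phi y == 0]| = #|[set v : 'rV[F]_(n * n) | v *m P == 0]|.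
  have inj_m : injective (fun y : 'M[F]_n => mxvec y) := can_inj mxvecK.
  rewrite -(card_imset _ inj_m); apply: eq_card => v; rewrite inE.
  apply/imsetP/idP => [[y + ->]|vP].
    by rewrite inE mul_vec_lin mxvec_eq0.
  by exists (vec_mx v); rewrite ?vec_mxK // inE -mxvec_eq0 -mul_vec_lin vec_mxK.
rewrite card_left_kernel -mxrank_tr -card_left_kernel.
have inj_mt : injective (fun y : 'M[F]_n => mxvec y^T).
  by move=> y z /(can_inj mxvecK)/trmx_inj.
have key y : (mxvec y^T *m P^T == 0) = (psi y == 0).
  rewrite -(inj_eq (@trmx_inj _ _ _)) trmx_mul trmxK trmx0.
  apply/eqP/eqP => [P0|psi0].
    suff /(congr1 trmx): (mxvec (psi y)^T)^T = 0.
      by rewrite trmxK trmx0 => /eqP; rewrite mxvec_eq0 => /eqP/(congr1 trmx); rewrite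
        trmxK trmx0.
    apply: col_eq0 => u; rewrite -[u]vec_mxK -mxtrace_mxvec -adj mxtrace_mxvec.
    by rewrite -mul_vec_lin -mulmxA P0 mulmx0 mxE.
  apply: col_eq0 => u; rewrite -[u]vec_mxK mulmxA mul_vec_lin -mxtrace_mxvec adj psi0.
  by rewrite mulmx0 mxtrace0.
rewrite -(card_imset _ inj_mt); apply: eq_card => v; rewrite inE.
apply/idP/imsetP => [vP|[y + ->]]; last by rewrite inE key.
exists (vec_mx v)^T; last by rewrite trmxK vec_mxK.
by rewrite inE -key trmxK vec_mxK.
Qed.

End TraceDuality.

(** The matrices commuting with [g] in the [(i, j)] block and in the [(j, i)]
    block are equally many: the two conditions are adjoint for the trace form. *)
Lemma card_commuting_block (F : finFieldType) n (g ei ej : 'M[F]_n) :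
  ei *m ei = ei -> ej *m ej = ej -> g *m ei = ei *m g -> g *m ej = ej *m g ->
  #|[set y | (ei *m y *m ej == y) && (g *m y == y *m g)]| =
  #|[set y | (ej *m y *m ei == y) && (g *m y == y *m g)]|.
Proof.
move=> eii ejj gi gj.
pose phi (c p q : 'M[F]_n) : {linear 'M[F]_n -> 'M[F]_n} :=
  ((mulmxr q \o mulmx p \o (mulmx c \- mulmxr c)) \+ (idfun \- (mulmxr q \o mulmx p)))%R.
have phiE c p q y : phi c p q y = p *m (c *m y - y *m c) *m q + (y - p *m y *m q) by [].
have kerE c p q : p *m p = p -> q *m q = q -> c *m p = p *m c -> c *m q = q *m c ->
    #|[set y | (p *m y *m q == y) && (c *m y == y *m c)]| = #|[set y | phi c p q y == 0]|.
  move=> pp qq gp gq; apply: eq_card => y; rewrite !inE phiE.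
  apply/andP/eqP => [[/eqP y1 /eqP y2]|phi0].
    by rewrite y1 y2 !subrr mulmx0 mul0mx addr0.
  have blk : p *m (c *m y - y *m c) *m q = 0.
    have E u : p *m (p *m u *m q) *m q = p *m u *m q by rewrite !mulmxA pp -!mulmxA qq.
    have E2 u v : p *m (p *m u *m q + (v - p *m v *m q)) *m q = p *m u *m q.
      by rewrite mulmxDr mulmxDl mulmxBr mulmxBl !E subrr addr0.
    by rewrite -(E2 _ y) phi0 mulmx0 mul0mx.
  move: phi0; rewrite blk add0r => /eqP; rewrite subr_eq0 => /eqP y1.
  split; first by rewrite -y1.
  move/eqP: blk; rewrite mulmxBr mulmxBl subr_eq0 => /eqP.
  have -> : p *m (c *m y) *m q = c *m (p *m y *m q) by rewrite mulmxA -gp !mulmxA.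
  have -> : p *m (y *m c) *m q = p *m y *m q *m c by rewrite mulmxA -(mulmxA _ c) gq
    !mulmxA.
  by rewrite -y1 => ->.
have -> : #|[set y | (ej *m y *m ei == y) && (g *m y == y *m g)]| =
          #|[set y | (ej *m y *m ei == y) && (- g *m y == y *m - g)]|.
  by apply: eq_card => y; rewrite !inE mulNmx mulmxN eqr_opp.
rewrite kerE // kerE ?mulNmx ?mulmxN ?gi ?gj //.
apply: card_kernel_adjoint => x y; rewrite !phiE.
have tr4 (p q u v : 'M[F]_n) : \tr (p *m u *m q *m v) = \tr (u *m (q *m v *m p)).
  by rewrite -!mulmxA mxtrace_mulC !mulmxA.
rewrite !(mulmxDl, mulmxDr, mulmxBl, mulmxBr, mulNmx, mulmxN) !(raddfD, raddfB, raddfN) /=.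
rewrite !opprK; congr (_ + (_ - _)); last by rewrite tr4.
rewrite [RHS]addrC; congr (_ - _).
  by rewrite mulmxA tr4 -gi !mulmxA.
by rewrite tr4 -!mulmxA (mulmxA g ej) gj !mulmxA.
Qed.

Section Orientation.
Variables (F : finFieldType) (V A : finType) (n : nat) (e : V -> 'M[F]_n).
Hypothesis e_orth : forall i j, e i *m e j = if i == j then e i else 0.
Hypothesis sum1 : \sum_i e i = 1%:M.
Variables (l : nat) (z : F) (w : V -> nat).
Hypothesis pr_l : prime l.
Hypothesis prim_z : l.-primitive_root z.

(** For the character [detw] below: trivial on the scalars of the representation,
    nontrivial on the scalars of every proper direct summand. *)
Hypothesis w_dim : (l %| \sum_i w i * \rank (e i))%N.
Hypothesis w_generic : forall d : V -> nat, (forall i, (d i <= \rank (e i))%N) ->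
  (l %| \sum_i w i * d i)%N -> (forall i, d i = 0%N) \/ (forall i, d i = \rank (e i)).

Let idem i : e i *m e i = e i. Proof. by rewrite e_orth eqxx. Qed.

Definition vertex_block i (g : 'M[F]_n) := row_base (e i) *m g *m col_base (e i).

Lemma vertex_block_mul i g g' : g *m e i = e i *m g ->
  vertex_block i (g *m g') = vertex_block i g *m vertex_block i g'.
Proof.
rewrite /vertex_block; have := mulmx_base (e i); have := idempotent_base (idem i).
move: (\rank (e i)) (col_base (e i)) (row_base (e i)) => r C R RC CR ge.
by rewrite !mulmxA -(mulmxA (R *m g) C) CR -(mulmxA R g (e i)) ge -CR !mulmxA RC mul1mx.
Qed.

Lemma vertex_block1 i : vertex_block i 1%:M = 1%:M.
Proof. by rewrite /vertex_block mulmx1 idempotent_base. Qed.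

(** The exponents [#|F|.-1 %/ l] put the values into the [l]-th roots of unity:
    a group of prime order, where the image of [Aut x] is trivial or everything. *)
Definition detw (g : 'M[F]_n) :=
  \prod_i \det (vertex_block i g) ^+ (w i * (#|F|.-1 %/ l)).

Definition vertex_auto : pred 'M[F]_n :=
  fun g => (g \in unitmx) && [forall i, g *m e i == e i *m g].

Lemma vertex_auto_comm g i : vertex_auto g -> g *m e i = e i *m g.
Proof. by case/andP => _ /forallP/(_ i)/eqP. Qed.

Lemma vertex_auto_mul g g' : vertex_auto g -> vertex_auto g' -> vertex_auto (g *m g').
Proof.
move=> gP g'P; apply/andP; split.
  by rewrite unitmx_mul; case/andP: gP => ->; case/andP: g'P => ->.
by apply/forallP => i; rewrite -mulmxA (vertex_auto_comm i g'P) mulmxA (vertex_auto_comm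
  i gP) mulmxA.
Qed.

Lemma detwM g g' : vertex_auto g -> detw (g *m g') = detw g * detw g'.
Proof.
move=> gP; rewrite /detw -big_split /=; apply: eq_bigr => i _.
by rewrite vertex_block_mul ?det_mulmx ?exprMn // vertex_auto_comm.
Qed.

Lemma detw1 : detw 1%:M = 1.
Proof. by rewrite /detw big1 // => i _; rewrite vertex_block1 det1 expr1n. Qed.

Lemma finField_expf_unit (u : F) : u != 0 -> u ^+ #|F|.-1 = 1.
Proof.
move=> u0; apply: (mulfI u0); rewrite -exprS prednK ?mulr1 ?expf_card //.
exact: ltnW (finNzRing_gt1 F).
Qed.

Lemma dvd_l_card : (l %| #|F|.-1)%N.
Proof.
rewrite (prim_order_dvd prim_z) finField_expf_unit //; apply/negP => /eqP z0.
have := prim_expr_order prim_z; rewrite z0 expr0n eqn0Ngt prime_gt0 //.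
by move/eqP; rewrite eq_sym oner_eq0.
Qed.

Lemma detw_exp g : vertex_auto g -> detw g ^+ l = 1.
Proof.
case/andP=> gu /forallP ge; rewrite /detw -prodrXl big1 // => i _.
rewrite -exprM -mulnA divnK ?dvd_l_card // mulnC exprM finField_expf_unit ?expr1n //.
have := vertex_block_mul (invmx g) (eqP (ge i)); rewrite mulmxV // vertex_block1.
move/(congr1 determinant); rewrite det1 det_mulmx; apply: contra_eq_neq => ->.
by rewrite mul0r oner_neq0.
Qed.

Section Weights.
Variable x : A -> 'M[F]_n.

Definition autos (v : F) : {set 'M[F]_n} :=
  [set g | [&& vertex_auto g, [forall a, g *m x a == x a *m g] & detw g == v]].

Lemma leq_autos_mul u v : u \in autos v -> forall v', (#|autos v'| <= #|autos (v *
  v')%R|)%N.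
Proof.
rewrite inE => /and3P[uP /forallP ux /eqP uv] v'.
have uu : u \in unitmx by case/andP: uP.
rewrite -(card_imset _ (can_inj (mulKmx uu))); apply: subset_leq_card.
apply/subsetP => _ /imsetP[g + ->]; rewrite !inE => /and3P[gP /forallP gx /eqP gv].
rewrite vertex_auto_mul // detwM // uv gv eqxx andbT /=; apply/forallP => a.
by rewrite -mulmxA (eqP (gx a)) mulmxA (eqP (ux a)) mulmxA.
Qed.

Lemma autos_exp u v i : u \in autos v -> u ^+ i \in autos (v ^+ i).
Proof.
move=> uv; elim: i => [|i IHi]; last first.
  rewrite !exprS -[u * _]/(u *m _); move: uv IHi; rewrite !inE.
  move=> /and3P[uP /forallP ux /eqP uv] /and3P[gP /forallP gx /eqP gv].
  rewrite vertex_auto_mul // detwM // uv gv eqxx andbT /=; apply/forallP => a.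
  by rewrite -mulmxA (eqP (gx a)) mulmxA (eqP (ux a)) mulmxA.
rewrite !expr0 inE /vertex_auto unitmx1 detw1 eqxx andbT /=.
by apply/andP; split; apply/forallP => i; rewrite mulmx1 mul1mx.
Qed.

(** A nontrivial value of [detw] makes its values on [Aut x] equidistributed. *)
Lemma autos_equidistributed u : u \in autos (detw u) -> detw u != 1 ->
  #|autos 1| = #|autos z|.
Proof.
move=> uP u1; have := uP; rewrite inE => /andP[/detw_exp ul _].
have prim_u : l.-primitive_root (detw u).
  have [m pm dvd_m] := prim_order_exists (prime_gt0 pr_l) ul.
  have /orP[/eqP m1|/eqP <- //] := (primeP pr_l).2 _ dvd_m.
  by move: u1; have := prim_expr_order pm; rewrite m1 expr1 => ->; rewrite eqxx.
have [i eq_z] := prim_rootP prim_u (prim_expr_order prim_z).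
have [j eq_z'] : {j : 'I_l | z^-1 = detw u ^+ j}.
  by apply: prim_rootP => //; rewrite exprVn (prim_expr_order prim_z) invr1.
apply/eqP; rewrite eqn_leq.
have := leq_autos_mul (autos_exp i uP) 1; rewrite -eq_z mulr1 => ->.
have := leq_autos_mul (autos_exp j uP) z; rewrite -eq_z' mulVf //.
apply/eqP => z0; have /eqP := prim_expr_order prim_z.
by rewrite z0 expr0n eqn0Ngt prime_gt0 // eq_sym oner_eq0.
Qed.
End Weights.

Hypothesis prim_e : primitive_dim (fun i => \rank (e i)).

(** On an indecomposable [x] an automorphism is a scalar [c] plus a nilpotent, so
    its twisted determinant is a power of [c ^+ #|F|.-1] by [w_dim]. *)
Lemma detw_indec (h t : A -> V) (x : A -> 'M[F]_n) g : is_mxrep h t e x -> mxindec e x ->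
  vertex_auto g -> (forall a, g *m x a = x a *m g) -> detw g = 1.
Proof.
move=> repx ind gP gx.
have eg : mxendo e x g by split=> [|i|a] //; rewrite ?sum1 ?mulmx1 // vertex_auto_comm.
have [c [m nil]] := mxindec_scalar_nilp repx ind sum1 prim_e eg.
have c0 : c != 0.
  have /andP[+ _] := gP; rewrite unitmxE unitfE (det_scalar_nilp nil) expf_eq0.
  by rewrite (mxrep_dim_gt0 prim_e).
have blk i : (vertex_block i g - c%:M) ^+ m = 0.
  have -> : vertex_block i g - c%:M = vertex_block i (g - c%:M).
    rewrite /vertex_block mulmxBr mulmxBl mul_mx_scalar -scalemxAl idempotent_base //.
    by rewrite scalemx1.
  have comm : (g - c%:M) *m e i = e i *m (g - c%:M).
    by rewrite mulmxBl mulmxBr (vertex_auto_comm i gP) mul_mx_scalar mul_scalar_mx.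
  have -> : vertex_block i (g - c%:M) ^+ m = vertex_block i ((g - c%:M) ^+ m).
    elim: m {nil} => [|m IHm]; first by rewrite !expr0 vertex_block1.
    by rewrite !exprS IHm -[_ * _ ^+ m]/(_ *m _ ^+ m) vertex_block_mul.
  by rewrite nil /vertex_block mulmx0 mul0mx.
rewrite /detw; under eq_bigr do rewrite (det_scalar_nilp (blk _)) -exprM.
have [q eq_q] := dvdnP w_dim.
rewrite prodrXr (_ : (\sum_i _)%N = (#|F|.-1 * q)%N); last first.
  transitivity (#|F|.-1 %/ l * \sum_i w i * \rank (e i))%N.
    by rewrite big_distrr /=; apply: eq_bigr => i _; rewrite mulnA mulnC [(\rank _ *
      _)%N]mulnC.
  by rewrite eq_q [(q * l)%N]mulnC mulnA divnK ?dvd_l_card.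
by rewrite exprM finField_expf_unit // expr1n.
Qed.

Lemma finField_prim_root : exists u : F, #|F|.-1.-primitive_root u.
Proof.
have F1 : (0 < #|F|.-1)%N by have := finNzRing_gt1 F; case: #|F| => [|[]].
have /hasP[u _ pu] : has (#|F|.-1).-primitive_root (enum (predC1 (0 : F))); last by
  exists u.
apply: has_prim_root => //.
- apply/allP => u; rewrite mem_enum inE => u0; rewrite unity_rootE.
  by rewrite finField_expf_unit.
- by rewrite enum_uniq.
- by rewrite -cardE cardC1.
Qed.

Lemma vertex_block_eq0 f : (forall i, f *m e i = e i *m f) ->
  (forall i, vertex_block i f = 0) -> f = 0.
Proof.
move=> fe f0; rewrite -[f]mulmx1 -sum1 mulmx_sumr big1 // => i _.
have -> : f *m e i = e i *m f *m e i by rewrite -mulmxA fe mulmxA idem.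
move: (f0 i) (mulmx_base (e i)); rewrite /vertex_block.
move: (\rank (e i)) (col_base (e i)) (row_base (e i)) => r C R RfC <-.
by rewrite !mulmxA -(mulmxA C R f) -(mulmxA C _ C) RfC mulmx0 mul0mx.
Qed.

Lemma vertex_auto_idempotent f (u : F) : u != 0 -> f *m f = f ->
  (forall i, f *m e i = e i *m f) -> vertex_auto (u *: f + (1%:M - f)).
Proof.
move=> u0 ff fe; apply/andP; split.
  by rewrite unitmxE det_idempotent // unitrX // unitfE.
apply/forallP => i; rewrite mulmxDl mulmxDr mulmxBl mulmxBr mul1mx mulmx1.
by rewrite -scalemxAl -scalemxAr fe.
Qed.

Lemma vertex_block_idempotent f i : f *m f = f -> f *m e i = e i *m f ->
  vertex_block i f *m vertex_block i f = vertex_block i f.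
Proof. by move=> ff fe; rewrite -vertex_block_mul // ff. Qed.

Lemma detw_idempotent f (u : F) : f *m f = f -> (forall i, f *m e i = e i *m f) ->
  detw (u *: f + (1%:M - f)) =
  u ^+ ((\sum_i w i * \rank (vertex_block i f)) * (#|F|.-1 %/ l)).
Proof.
move=> ff fe; rewrite /detw big_distrl -prodrXr /=; apply: eq_bigr => i _.
have -> : vertex_block i (u *: f + (1%:M - f)) =
          u *: vertex_block i f + (1%:M - vertex_block i f).
  rewrite {1}/vertex_block mulmxDr mulmxDl mulmxBr mulmxBl -scalemxAr -scalemxAl.
  by rewrite -/(vertex_block i f) -/(vertex_block i 1%:M) vertex_block1.
by rewrite det_idempotent ?vertex_block_idempotent // -exprM mulnA [(w i * _)%N]mulnC.
Qed.

(** A direct summand [f], rescaled by a generator [u] of the units of [F], is an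
    automorphism with nontrivial [detw], by [w_generic]. *)
Lemma autos_decomposable (x : A -> 'M[F]_n) : ~ mxindec e x ->
  #|autos x 1| = #|autos x z|.
Proof.
move=> dec; have [f [[[_ fe fx] ff] f0 f1]] : exists f,
    [/\ mxendo e x f /\ f *m f = f, f <> 0 & f <> 1%:M].
  apply: NNPP => no; apply: dec => f ef ff; rewrite sum1.
  case: (classic (f = 0)) => [|f0]; [by left | right].
  by apply: NNPP => f1; apply: no; exists f.
have [u pu] := finField_prim_root.
have u0 : u != 0.
  apply/negP => /eqP u0; have /eqP := prim_expr_order pu.
  by rewrite u0 expr0n eqn0Ngt (prim_order_gt0 pu) eq_sym oner_eq0.
pose g := u *: f + (1%:M - f).
have gP : g \in autos x (detw g).
  rewrite inE vertex_auto_idempotent // eqxx andbT /=; apply/forallP => a.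
  rewrite /g mulmxDl mulmxDr mulmxBl mulmxBr mul1mx mulmx1.
  by rewrite -scalemxAl -scalemxAr fx.
apply: (autos_equidistributed gP); rewrite detw_idempotent // -(prim_order_dvd pu).
rewrite -{1}(divnK dvd_l_card) [(_ %/ l * l)%N]mulnC dvdn_pmul2r; last first.
  by rewrite divn_gt0 ?prime_gt0 // dvdn_leq ?dvd_l_card // (prim_order_gt0 pu).
apply/negP => /w_generic [i|all0|all1]; first by rewrite rank_leq_row.
  by apply: f0; apply: vertex_block_eq0 => // i; apply/eqP; rewrite -mxrank_eq0 all0.
apply: f1; apply/eqP; rewrite -subr_eq0; apply/eqP/vertex_block_eq0 => i.
  by rewrite mulmxBl mulmxBr mul1mx mulmx1 fe.
rewrite /vertex_block mulmxBr mulmxBl -/(vertex_block i 1%:M) -/(vertex_block i f).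
have fu : vertex_block i f \in unitmx by rewrite -row_full_unit /row_full all1.
rewrite vertex_block1 -(mulmxV fu) -{2}(vertex_block_idempotent ff (fe i)).
by rewrite mulmxK // subrr.
Qed.

Definition mxreps (h t : A -> V) : {set {ffun A -> 'M[F]_n}} :=
  [set x : {ffun A -> 'M[F]_n} | [forall a, e (t a) *m x a *m e (h a) == x a]].

Lemma mxrepsP h t (x : {ffun A -> 'M[F]_n}) : reflect (is_mxrep h t e x) (x \in mxreps h t).
Proof.
rewrite inE; apply: (iffP forallP) => [xP|[_ xP] a]; last by rewrite xP.
by split=> // a; apply/eqP.
Qed.

Definition count_autos h t v := (\sum_(x in mxreps h t) #|autos x v|)%N.

(** Exchanging the two sums: the representations fixed by [g] are a product over
    the arrows, and reversing an arrow leaves its factor unchanged. *)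
Lemma count_autos_eq h t h' t' v :
  (forall a, (h' a = h a /\ t' a = t a) \/ (h' a = t a /\ t' a = h a)) ->
  count_autos h t v = count_autos h' t' v.
Proof.
move=> flip.
pose blk (h0 t0 : A -> V) g a : pred 'M[F]_n :=
  [pred y | (e (t0 a) *m y *m e (h0 a) == y) && (g *m y == y *m g)].
have countE (h0 t0 : A -> V) : count_autos h0 t0 v =
    (\sum_(g | vertex_auto g && (detw g == v)) foldr muln 1 [seq #|blk h0 t0 g a| | a :
      A])%N.
  rewrite /count_autos; under eq_bigr do rewrite -sum1_card.
  rewrite (exchange_big_dep (fun g => vertex_auto g && (detw g == v))) /=; last first.
    by move=> x g _; rewrite inE => /and3P[-> _ ->].
  apply: eq_bigr => g /andP[gP gv]; rewrite sum1_card -card_family; apply: eq_card => x.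
  rewrite [LHS]inE /= [x \in _]inE [g \in _]inE gP gv andbT /=.
  apply/andP/familyP => [[/forallP x1 /forallP x2] a|xP]; first by rewrite inE x1 x2.
  by split; apply/forallP => a; have := xP a; rewrite inE => /andP[].
rewrite !countE; apply: eq_bigr => g /andP[gP _]; congr foldr; apply: eq_map => a.
have cardE h0 t0 : #|blk h0 t0 g a| =
    #|[set y | (e (t0 a) *m y *m e (h0 a) == y) && (g *m y == y *m g)]|.
  by apply: eq_card => y; rewrite !inE.
rewrite !cardE; case: (flip a) => [[-> ->] //|[-> ->]].
by apply: card_commuting_block; rewrite ?idem // vertex_auto_comm.
Qed.

(** The difference of [count_autos] at [1] and at [z] only sees indecomposable
    representations, and each of them contributes a positive amount. *)
Theorem mxindec_reorient h t h' t' (x : A -> 'M[F]_n) :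
  (forall a, (h' a = h a /\ t' a = t a) \/ (h' a = t a /\ t' a = h a)) ->
  is_mxrep h t e x -> mxindec e x ->
  exists x', is_mxrep h' t' e x' /\ mxindec e x'.
Proof.
move=> flip repx ind.
have eq1 := count_autos_eq 1 flip; have eqz := count_autos_eq z flip.
apply: NNPP => no.
have eq' : count_autos h' t' 1 = count_autos h' t' z.
  apply: eq_bigr => y /mxrepsP repy; apply: autos_decomposable => indy.
  by apply: no; exists y.
have: (count_autos h t z < count_autos h t 1%R)%N; last by rewrite eq1 eqz eq' ltnn.
pose X : {ffun A -> 'M[F]_n} := [ffun a => x a].
have repX : is_mxrep h t e X by split=> [|a]; rewrite ?repx.1 // !ffunE repx.2.
have indX : mxindec e X.
  by move=> f [fE fe fx]; apply: ind; split=> // a; have := fx a; rewrite ffunE.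
have autos_z y : is_mxrep h t e y -> mxindec e y -> autos y z = set0.
  move=> repy indy; apply/setP => g; rewrite !inE; apply/negP => /and3P[gP /forallP gy
    /eqP gz].
  have z1 : z = 1 by rewrite -gz (detw_indec repy indy gP) // => a; apply/eqP.
  have := prim_order_dvd prim_z 1; rewrite z1 expr1n eqxx dvdn1 => /eqP l1.
  by have := prime_gt1 pr_l; rewrite l1.
rewrite /count_autos (bigD1 X) ?[X in (_ < X)%N](bigD1 X) /=; try exact/mxrepsP.
rewrite (autos_z X) // cards0 add0n -[X in (X < _)%N]add0n -addSn leq_add //.
  rewrite card_gt0; apply/set0Pn; exists 1%:M; rewrite inE detw1 eqxx andbT.
  rewrite /vertex_auto unitmx1 /=; apply/andP.
  by split; apply/forallP => i; rewrite mulmx1 mul1mx.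
apply: leq_sum => y /andP[/mxrepsP repy _].
case: (classic (mxindec e y)) => [indy|decy]; last by rewrite autos_decomposable.
by rewrite autos_z // cards0.
Qed.

End Orientation.

(** * Generic weights *)

Lemma avoid_functionals (I : finType) (cs : seq {ffun I -> int}) :
  (forall c, c \in cs -> exists i, c i != 0) ->
  exists T : I -> int, forall c, c \in cs -> \sum_i T i * c i != 0.
Proof.
elim: cs => [|c cs IHcs] nz; first by exists (fun=> 0).
have [|T TP] := IHcs; first by move=> c' c'cs; apply: nz; rewrite inE c'cs orbT.
have [Tc|Tc] := eqVneq (\sum_i T i * c i) 0; last first.
  by exists T => c'; rewrite inE => /predU1P[->|/TP].
have [i ci] := nz c (mem_head _ _).
pose M : int := 1 + \sum_(c' <- cs) `|c' i|.
(* [M] is so large that the correction at [i] cannot cancel a nonzero value. *)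
exists (fun j => M * T j + (j == i)%:R) => c' c'in.
have -> : \sum_j (M * T j + (j == i)%:R) * c' j = M * (\sum_j T j * c' j) + c' i.
  under eq_bigr do rewrite mulrDl -mulrA.
  rewrite big_split /= -mulr_sumr; congr (_ + _); rewrite (bigD1 i) //= eqxx mul1r.
  by rewrite big1 ?addr0 // => j /negPf->; rewrite mul0r.
move: c'in; rewrite inE => /predU1P[->|c'cs]; first by rewrite Tc mulr0 add0r.
have := TP _ c'cs; set s := \sum_j _ => s0.
rewrite addr_eq0; apply: contraTneq isT => /(congr1 Num.norm); rewrite normrN normrM.
have lt_M : `|c' i| < `|M|.
  have leS : `|c' i| <= \sum_(c' <- cs) `|c' i|.
    by rewrite (big_rem c') //= lerDl sumr_ge0.
  have S0 := le_trans (normr_ge0 (c' i)) leS.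
  by rewrite [ `|M| ]ger0_norm /M; [rewrite addrC ltzD1 | rewrite addr_ge0].
move=> eqM; move: lt_M; rewrite -eqM ltNge ler_peMr //.
by rewrite -gtz0_ge1 normr_gt0.
Qed.

Lemma primitive_proportional (V : finType) (d c : V -> nat) :
  primitive_dim d -> (forall i, (c i <= d i)%N) ->
  (forall i j, (c i * d j = c j * d i)%N) ->
  (forall i, c i = 0%N) \/ (forall i, c i = d i).
Proof.
move=> prim le_cd prop.
have [i di] : exists i, (0 < d i)%N.
  apply: NNPP => no; have /prim // : forall i, (2 %| d i)%N.
  by move=> i; rewrite (_ : d i = 0%N) //; apply/eqP; rewrite -leqn0 leqNgt; apply/negP
    => di; apply: no; exists i.
have [g [a [b [g0 eq_c eq_d cop]]]] : exists g a b,
    [/\ (0 < g)%N, c i = (a * g)%N, d i = (b * g)%N & coprime b a].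
  pose g := gcdn (c i) (d i); have g0 : (0 < g)%N by rewrite gcdn_gt0 di orbT.
  exists g, (c i %/ g)%N, (d i %/ g)%N; rewrite !divnK ?dvdn_gcdl ?dvdn_gcdr //; split=> //.
  rewrite coprime_sym /coprime -(eqn_pmul2r g0) muln_gcdl.
  by rewrite !divnK ?dvdn_gcdl ?dvdn_gcdr // mul1n.
have propg j : (a * d j = c j * b)%N.
  by apply/eqP; rewrite -(eqn_pmul2r g0) mulnAC -eq_c prop eq_d mulnA.
have b1 : b = 1%N by apply: prim => j; rewrite -(Gauss_dvdr _ cop) propg dvdn_mull.
have cE j : c j = (a * d j)%N by rewrite propg b1 muln1.
have := le_cd i; rewrite cE -[X in (_ <= X)%N]mul1n leq_pmul2r //.
case: a {eq_c cop propg} cE => [|[|m]] // cE _; first by left=> j; rewrite cE.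
by right=> j; rewrite cE mul1n.
Qed.

(** Skew-symmetric [T] gives weights [w i = \sum_j (T i j - T j i) d j] killing
    [d]; their value on [c] is a combination of the minors of [(c, d)], and a
    generic [T] keeps it nonzero unless [c] is proportional to [d]. Beyond the
    bound, [l] exceeds all these values, and so divides none of them. *)
Lemma generic_weights (V : finType) (d : V -> nat) : primitive_dim d ->
  exists B : nat, forall l, prime l -> (B < l)%N -> exists w : V -> nat,
    (l %| \sum_i w i * d i)%N /\
    forall c : V -> nat, (forall i, (c i <= d i)%N) -> (l %| \sum_i w i * c i)%N ->
      (forall i, c i = 0%N) \/ (forall i, c i = d i).
Proof.
move=> prim; pose D := (\sum_i d i).+1.
pose minors (c : V -> nat) : {ffun V * V -> int} :=
  [ffun p => (c p.1)%:Z * (d p.2)%:Z - (c p.2)%:Z * (d p.1)%:Z].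
pose nontriv (m : {ffun V * V -> int}) := [exists p, m p != 0].
pose cs := [seq m <- [seq minors (fun i => f i : nat) | f : {ffun V -> 'I_D}] | nontriv m].
have [|T TP] := @avoid_functionals _ cs.
  by move=> m; rewrite mem_filter => /andP[/existsP].
pose val m := \sum_p T p * m p.
pose n i : int := \sum_j (T (i, j) - T (j, i)) * (d j)%:Z.
have valE c : val (minors c) = \sum_i n i * (c i)%:Z.
  rewrite /val; transitivity (\sum_i \sum_j T (i, j) * ((c i)%:Z * (d j)%:Z - (c j)%:Z *
    (d i)%:Z)).
    by rewrite pair_bigA; apply: eq_bigr => -[i j] _ /=; rewrite ffunE.
  under eq_bigr do (under eq_bigr do rewrite mulrBr; rewrite sumrB).
  rewrite sumrB [X in _ - X]exchange_big -sumrB; apply: eq_bigr => i _ /=.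
  rewrite -sumrB mulr_suml; apply: eq_bigr => j _; ring.
exists (\sum_(m <- cs) `|val m|%N)%N => l pr_l ltl.
have l0 : l%:Z != 0 by rewrite -lt0n prime_gt0.
pose w i := `|(n i %% l%:Z)%Z|%N.
have wE c : (l %| \sum_i w i * c i)%N = (l%:Z %| val (minors c))%Z.
  rewrite valE -[LHS]/(l%:Z %| (\sum_i w i * c i)%N%:Z)%Z.
  have -> : \sum_i n i * (c i)%:Z =
      (\sum_i (n i %/ l%:Z)%Z * (c i)%:Z) * l%:Z + (\sum_i w i * c i)%N%:Z.
    rewrite mulr_suml (big_morph Posz PoszD (erefl _)) -big_split /=; apply: eq_bigr => i _.
    rewrite PoszM /w gez0_abs ?modz_ge0 // {1}(divz_eq (n i) l) mulrDl.
    by rewrite mulrAC.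
  by rewrite rpredDl // dvdz_mull.
exists w; split=> [|c le_cd].
  rewrite wE (_ : minors d = [ffun=> 0]).
    by rewrite /val big1 // => p _; rewrite ffunE mulr0.
  by apply/ffunP => p; rewrite !ffunE mulrC subrr.
rewrite wE => dvd_l.
have [nt|triv] := boolP (nontriv (minors c)); last first.
  apply: primitive_proportional => // i j; apply/eqP; move: triv; rewrite negb_exists.
  by move=> /forallP/(_ (i, j)); rewrite ffunE negbK subr_eq0 /= -!PoszM eqz_nat.
have csP : minors c \in cs.
  rewrite mem_filter nt /=; apply/mapP; exists [ffun i => inord (c i) : 'I_D].
    by rewrite mem_enum.
  apply/ffunP => p; rewrite !ffunE !inordK // ltnS (leq_trans (le_cd _)) //.
    by rewrite (bigD1 p.2) //= leq_addr.
  by rewrite (bigD1 p.1) //= leq_addr.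
have := TP _ csP; rewrite -/(val _) => v0; have := dvdn_leq _ dvd_l.
rewrite absz_gt0 v0 => /(_ isT); rewrite leqNgt (leq_ltn_trans _ ltl) //.
by rewrite (big_rem _ csP) /= leq_addr.
Qed.

(** * Reflection at a sink *)

Section CopyEmbedding.
Variables (k : fieldType) (A : finType) (n : nat).

(** The embedding of the [a]-th copy of [k^n] into [(k^n)^A]. *)
Definition copy_mx (a : A) : 'M[k]_(n, #|{: A * 'I_n}|) :=
  \matrix_(u, w) (enum_val w == (a, u))%:R.

Lemma copy_mx_orth a b : copy_mx a *m (copy_mx b)^T = if a == b then 1%:M else 0.
Proof.
apply/matrixP => u v; rewrite mxE (bigD1 (enum_rank (a, u))) //= big1 ?addr0 => [|w ne].
  rewrite !mxE enum_rankK eqxx mul1r xpair_eqE.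
  by case: (a == b); rewrite ?mxE.
rewrite !mxE (_ : (enum_val w == (a, u)) = false) ?mul0r //.
by apply: contraNF ne => /eqP <-; rewrite enum_valK.
Qed.

End CopyEmbedding.

Lemma rank_orth_sum (k : fieldType) (I : finType) n (P : pred I) (E : I -> 'M[k]_n) :
  (forall a b, E a *m E b = if a == b then E a else 0) ->
  \rank (\sum_(a | P a) E a)%R = (\sum_(a | P a) \rank (E a))%N.
Proof.
move=> orth; rewrite -!(big_filter (index_enum I)).
have : uniq [seq a <- index_enum I | P a] by rewrite filter_uniq ?index_enum_uniq.
elim: [seq a <- _ | _] => [|a s IHs]; first by rewrite !big_nil mxrank0.
rewrite /= => /andP[a_s us]; rewrite !big_cons -IHs //.
have aE : E a *m \sum_(b <- s) E b = 0.
  rewrite mulmx_sumr big_seq big1 // => b bs; rewrite orth; case: eqP => // ab.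
  by rewrite ab bs in a_s.
have Ea : (\sum_(b <- s) E b) *m E a = 0.
  rewrite mulmx_suml big_seq big1 // => b bs; rewrite orth; case: eqP => // ab.
  by rewrite -ab bs in a_s.
rewrite rank_orth_add ?orth ?eqxx // mulmx_suml big_seq [RHS]big_seq.
apply: eq_bigr => b bs; rewrite mulmx_sumr (bigD1_seq b) //= orth eqxx big1 ?addr0 // =>
  c cb.
by rewrite orth eq_sym (negPf cb).
Qed.

Section Reflection.
Variables (k : fieldType) (V A : finType) (h t : A -> V) (i : V) (n : nat).
Variables (e : V -> 'M[k]_n) (x : A -> 'M[k]_n).
Hypothesis repx : is_mxrep h t e x.
Hypothesis indx : mxindec e x.
Hypothesis sink : forall a, t a != i.

Local Notation J a := (@copy_mx k A n a).
Local Notation E := (\sum_j e j).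

(** [Phi] collects the arrows into [i], and [eW] projects [(k^n)^A] onto the
    direct sum of the spaces at their tails, where [Phi] starts. *)
Let eW := \sum_(a | h a == i) (J a)^T *m e (t a) *m J a.
Let Phi := \sum_(a | h a == i) (J a)^T *m x a.

Let eer r (M : 'M_(r, n)) j : M *m e j *m e j = M *m e j.
Proof. by rewrite -mulmxA (mxrep_idem repx). Qed.

Let JJ a : J a *m (J a)^T = 1%:M. Proof. by rewrite copy_mx_orth eqxx. Qed.

Let J_sum (r : nat) (G : A -> 'M[k]_(n, r)) a : h a == i ->
  J a *m (\sum_(b | h b == i) (J b)^T *m G b) = G a.
Proof.
move=> ha; rewrite mulmx_sumr (bigD1 a) //= mulmxA JJ mul1mx big1 ?addr0 // => b /andP[_
  ba].
by rewrite mulmxA copy_mx_orth eq_sym (negPf ba) mul0mx.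
Qed.

Let sum_J (r : nat) (G : A -> 'M[k]_(r, n)) a : h a == i ->
  (\sum_(b | h b == i) G b *m J b) *m (J a)^T = G a.
Proof.
move=> ha; rewrite mulmx_suml (bigD1 a) //= -mulmxA JJ mulmx1 big1 ?addr0 // => b /andP[_
  ba].
by rewrite -mulmxA copy_mx_orth (negPf ba) mulmx0.
Qed.

Let JPhi a : h a == i -> J a *m Phi = x a. Proof. exact: J_sum. Qed.

Let eWJ a : h a == i -> eW *m (J a)^T = (J a)^T *m e (t a).
Proof. by move=> ha; rewrite (sum_J (fun a => (J a)^T *m e (t a))). Qed.

Let eWPhi : eW *m Phi = Phi.
Proof.
rewrite mulmx_sumr; apply: eq_bigr => a ha.
by rewrite mulmxA eWJ // -mulmxA (mxrep_tail repx).
Qed.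

Let eWW : eW *m eW = eW.
Proof.
rewrite {2}/eW mulmx_sumr; apply: eq_bigr => a ha.
by rewrite !mulmxA eWJ // eer.
Qed.

Let Phi_e : Phi *m e i = Phi.
Proof.
rewrite mulmx_suml; apply: eq_bigr => a ha.
by rewrite -mulmxA -(eqP ha) (mxrep_head repx).
Qed.

Let rank_eW : \rank eW = (\sum_(a | h a == i) \rank (e (t a)))%N.
Proof.
rewrite rank_orth_sum => [|a b].
  apply: eq_bigr => a _; apply/eqP; rewrite eqn_leq.
  rewrite (leq_trans (mxrankM_maxl _ _)) ?mxrankM_maxr //=.
  have {1}-> : e (t a) = J a *m ((J a)^T *m e (t a) *m J a) *m (J a)^T.
    by rewrite !mulmxA JJ mul1mx -mulmxA JJ mulmx1.
  by rewrite (leq_trans (mxrankM_maxl _ _)) ?mxrankM_maxr.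
rewrite !mulmxA -(mulmxA _ (J a)) copy_mx_orth; case: eqP => [<-|_].
  by rewrite mulmx1 eer.
by rewrite mulmx0 !mul0mx.
Qed.

(** A complement of the image of [Phi] in [V_i] splits off as copies of the
    simple representation at the sink [i]. *)
Lemma sink_split : (forall j, j != i -> \rank (e j) = 0%N) \/
  exists Psi, [/\ Psi *m Phi = e i, e i *m Psi = Psi & Psi *m eW = Psi].
Proof.
pose T := pinvmx Phi *m Phi; pose p := e i - e i *m T.
have PhiT : Phi *m T = Phi by rewrite /T mulmxA mulmxKpV.
have Te : T *m e i = T by rewrite /T -mulmxA Phi_e.
have TT : T *m T = T by rewrite {1}/T -mulmxA PhiT.
have pe : p *m e i = p by rewrite mulmxBl (mxrep_idem repx) -mulmxA Te.
have ep : e i *m p = p by rewrite mulmxBr mulmxA (mxrep_idem repx).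
have pp : p *m p = p.
  rewrite {2}/p mulmxBr mulmxA pe mulmxBl -mulmxA TT.
  by rewrite subrr subr0.
have xp a : x a *m p = 0.
  have [ha|ha] := boolP (h a == i); last first.
    by rewrite -ep mulmxA (mxrep_head0 repx) ?mul0mx // eq_sym.
  rewrite -(JPhi ha) -mulmxA mulmxBr mulmxA Phi_e PhiT subrr mulmx0 //.
have px a : p *m x a = 0.
  by rewrite -pe -mulmxA (mxrep_tail0 repx) ?mulmx0 // eq_sym sink.
have [||p0|p1] := @indx p.
- split=> [|j|a]; last by rewrite xp px.
    by rewrite -{1}pe -mulmxA (mxrep_suml repx).
  have [->|ne] := eqVneq j i; first by rewrite pe ep.
  rewrite -{1}pe -{2}ep mulmxA -mulmxA.
  by rewrite !(mxrep_orth repx) ?mul0mx ?mulmx0 // eq_sym.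
- exact: pp.
- right; exists (e i *m pinvmx Phi *m eW); split.
  + by rewrite -mulmxA eWPhi -mulmxA -/T; apply/esym/eqP; rewrite -subr_eq0 -/p p0.
  + by rewrite !mulmxA (mxrep_idem repx).
  + by rewrite -mulmxA eWW.
- left=> j ne; rewrite -(mxrep_suml repx j) -p1 -ep mulmxA (mxrep_orth repx) //.
  by rewrite mul0mx mxrank0.
Qed.

Variable Psi : 'M[k]_(n, #|{: A * 'I_n}|).
Hypothesis PsiPhi : Psi *m Phi = e i.
Hypothesis ePsi : e i *m Psi = Psi.
Hypothesis PsieW : Psi *m eW = Psi.

(** Projection of the incoming space onto the kernel of [Phi]. *)
Let eK := eW - Phi *m Psi.

Let eKPhi : eK *m Phi = 0.
Proof. by rewrite mulmxBl eWPhi -mulmxA PsiPhi Phi_e subrr. Qed.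

Let eKeW : eK *m eW = eK.
Proof. by rewrite mulmxBl eWW -mulmxA PsieW. Qed.

Let eKK : eK *m eK = eK.
Proof. by rewrite {2}/eK mulmxBr eKeW mulmxA eKPhi mul0mx subr0. Qed.

Let rank_eK : (\rank eK + \rank (e i) = \sum_(a | h a == i) \rank (e (t a)))%N.
Proof.
rewrite -rank_eW -[eW in RHS](subrK (Phi *m Psi)) -/eK.
have PP : Phi *m Psi *m (Phi *m Psi) = Phi *m Psi.
  by rewrite mulmxA -(mulmxA Phi) PsiPhi Phi_e.
rewrite (@rank_orth_add _ _ eK (Phi *m Psi)) //; last 2 first.
- by rewrite mulmxA eKPhi mul0mx.
- by rewrite /eK mulmxBr -mulmxA PsieW PP subrr.
congr (_ + _)%N; apply/eqP; rewrite eqn_leq; apply/andP; split.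
  have {1}-> : e i = Psi *m (Phi *m Psi) *m Phi by rewrite !mulmxA PsiPhi -mulmxA PsiPhi
    (mxrep_idem repx).
  by rewrite (leq_trans (mxrankM_maxl _ _)) ?mxrankM_maxr.
by rewrite -ePsi mulmxA (leq_trans (mxrankM_maxl _ _)) ?mxrankM_maxr.
Qed.

Let E1 := \sum_(j | j != i) e j.

Let EE1 : E = e i + E1. Proof. by rewrite (bigD1 i). Qed.

Let E1e j : j != i -> E1 *m e j = e j.
Proof.
move=> ne; rewrite mulmx_suml (bigD1 j) //= (mxrep_idem repx) big1 ?addr0 // => j'
  /andP[_ ne'].
by rewrite (mxrep_orth repx).
Qed.

Let E1ei : E1 *m e i = 0.
Proof. by rewrite mulmx_suml big1 // => j ne; rewrite (mxrep_orth repx). Qed.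

Let eiE1 : e i *m E1 = 0.
Proof. by rewrite mulmx_sumr big1 // => j ne; rewrite (mxrep_orth repx) // eq_sym. Qed.

(** An endomorphism of the reflection is [phi] away from [i] and [kappa] on the
    kernel. The map [W] that [phi] induces on the direct sum restricts to [kappa]
    there, hence descends along [Phi] to an endomorphism at [i]. *)
Lemma reflect_endo phi kappa :
  phi *m E1 = phi -> (forall j, j != i -> phi *m e j = e j *m phi) ->
  kappa *m eK = kappa -> eK *m kappa = kappa -> phi *m phi = phi ->
  (forall a, h a != i -> phi *m x a = x a *m phi) ->
  (forall a, h a == i ->
     kappa *m (eK *m (J a)^T *m e (t a)) = eK *m (J a)^T *m e (t a) *m phi) ->
  (phi = 0 /\ kappa = 0) \/ (phi = E1 /\ kappa = eK).
Proof.
move=> phiE1 phie kK Kk pp phix kx.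
have E1phi : E1 *m phi = phi.
  by rewrite -{2}phiE1 mulmx_suml mulmx_sumr; apply: eq_bigr => j ne; rewrite phie.
have phi_ei : phi *m e i = 0 by rewrite -phiE1 -mulmxA E1ei mulmx0.
have ei_phi : e i *m phi = 0 by rewrite -E1phi mulmxA eiE1 mul0mx.
pose W := \sum_(a | h a == i) (J a)^T *m phi *m e (t a) *m J a.
have JW a : h a == i -> J a *m W = phi *m e (t a) *m J a.
  move=> ha; rewrite /W; under eq_bigr do rewrite -!mulmxA.
  by rewrite (J_sum (fun a => phi *m (e (t a) *m J a))) // mulmxA.
have WW : W *m W = W.
  rewrite {1}/W mulmx_suml; apply: eq_bigr => a ha.
  have step : phi *m e (t a) *m phi *m e (t a) = phi *m e (t a).
    by rewrite -(mulmxA phi) -phie ?sink // mulmxA pp eer.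
  by rewrite -mulmxA JW // !mulmxA -!(mulmxA (J a)^T) step.
have eWW' : eW *m W = W.
  rewrite mulmx_suml; apply: eq_bigr => a ha; rewrite -mulmxA JW // phie ?sink //.
  by rewrite !mulmxA eer -(mulmxA _ (e (t a)) phi) -phie ?sink // mulmxA.
have eq_k : kappa = eK *m W.
  rewrite -{1}kK -{1}eKeW /eW /W !mulmx_sumr; apply: eq_bigr => a ha.
  have := kx a ha; rewrite !mulmxA => ->.
  by rewrite -(mulmxA _ (e _) phi) -phie ?sink // !mulmxA.
have kPhi : eK *m W *m Phi = 0 by rewrite -eq_k -kK -mulmxA eKPhi mulmx0.
pose f := phi + Psi *m W *m Phi.
have phiPsi : phi *m Psi = 0 by rewrite -ePsi mulmxA phi_ei mul0mx.
have PhiPhi : Phi *m phi = 0 by rewrite -Phi_e -mulmxA ei_phi mulmx0.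
have PhiE1 : Phi *m E1 = 0 by rewrite -Phi_e -mulmxA eiE1 mulmx0.
have phif : phi = f *m E1 by rewrite mulmxDl phiE1 -mulmxA PhiE1 mulmx0 addr0.
have [||f0|f1] := @indx f.
- split=> [|j|a].
  + by rewrite mulmxDl EE1 mulmxDr phi_ei add0r phiE1 -(mulmxA _ Phi) mulmxDr Phi_e
    -{2}Phi_e -(mulmxA Phi) eiE1 mulmx0 addr0.
  + have [->|ne] := eqVneq j i.
      by rewrite mulmxDl mulmxDr phi_ei ei_phi -(mulmxA _ Phi) Phi_e !mulmxA ePsi.
    rewrite mulmxDl mulmxDr phie // -{1}Phi_e -{2}ePsi !mulmxA -(mulmxA _ (e i)).
    by rewrite !(mxrep_orth repx) ?mulmx0 ?mul0mx // eq_sym.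
  + have Phix : Phi *m x a = 0.
      by rewrite -Phi_e -mulmxA (mxrep_tail0 repx) ?mulmx0 // eq_sym sink.
    have [ha|ha] := boolP (h a == i); last first.
      have xPsi : x a *m Psi = 0.
        by rewrite -ePsi mulmxA (mxrep_head0 repx) ?mul0mx // eq_sym.
      by rewrite mulmxDl mulmxDr phix // -mulmxA Phix !mulmxA xPsi mulmx0 !mul0mx.
    have xPsi : x a *m Psi = J a *m (eW - eK) by rewrite -(JPhi ha) -mulmxA /eK subKr.
    rewrite mulmxDl mulmxDr -(mulmxA _ Phi) Phix mulmx0 addr0 -{2}(JPhi ha) -mulmxA
      PhiPhi mulmx0 add0r.
    rewrite !mulmxA xPsi -!mulmxA mulmxBl mulmxBr (mulmxA eK) kPhi mulmx0 subr0.
    by rewrite (mulmxA eW) eWW' mulmxA JW // -!mulmxA JPhi // (mxrep_tail repx).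
- have PhiPsi : Phi *m Psi = eW - eK by rewrite /eK subKr.
  have key : Psi *m W *m Phi *m (Psi *m W *m Phi) = Psi *m W *m Phi.
    rewrite !mulmxA -(mulmxA _ Phi Psi) PhiPsi mulmxBr !mulmxBl.
    rewrite -(mulmxA (Psi *m W) eW W) eWW' -(mulmxA Psi W W) WW.
    by rewrite -(mulmxA (Psi *m W) eK W) -(mulmxA _ (eK *m W) Phi) kPhi mulmx0 subr0.
  rewrite mulmxDl !mulmxDr pp key -(mulmxA _ Phi phi) PhiPhi mulmx0 add0r.
  by rewrite !mulmxA phiPsi !mul0mx addr0.
- left; have phi0 : phi = 0 by rewrite phif f0 mul0mx.
  split=> //; rewrite eq_k /W phi0 big1 ?mulmx0 // => a _.
  by rewrite mulmx0 !mul0mx.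
- right; have phi1 : phi = E1.
    rewrite phif.
    by rewrite f1 EE1 mulmxDl eiE1 add0r mulmx_sumr; apply: eq_bigr => j ne; rewrite E1e.
  split=> //; rewrite eq_k -[RHS]eKeW; congr (_ *m _); apply: eq_bigr => a _.
  by rewrite phi1 -(mulmxA _ E1) E1e.
Qed.

Let e' j : 'M[k]_(n + #|{: A * 'I_n}|) :=
  if j == i then block_mx 0 0 0 eK else block_mx (e j) 0 0 0.
Let x' a : 'M[k]_(n + #|{: A * 'I_n}|) :=
  if h a == i then block_mx 0 0 (eK *m (J a)^T *m e (t a)) 0
  else block_mx (x a) 0 0 0.
Let h' a := if h a == i then t a else h a.
Let t' a := if h a == i then i else t a.

Let e'E j : j != i -> e' j = block_mx (e j) 0 0 0.
Proof. by rewrite /e' => /negPf->. Qed.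

Let e'i : e' i = block_mx 0 0 0 eK.
Proof. by rewrite /e' eqxx. Qed.

Let sum_e' : \sum_j e' j = block_mx E1 0 0 eK.
Proof.
rewrite (bigD1 i) //= e'i; under eq_bigr do rewrite e'E //.
have blk0 : block_mx 0 0 0 0 = 0 :> 'M[k]_(n + #|{: A * 'I_n}|) by rewrite block_mx0.
have blkD : {morph (fun y => block_mx y 0 0 0 : 'M[k]_(n + #|{: A * 'I_n}|)) : y z / y + z}.
  by move=> y z; rewrite add_block_mx !addr0.
rewrite -(big_morph _ blkD blk0) -/E1.
by rewrite add_block_mx !addr0 add0r.
Qed.

Lemma reflect_mxrep : is_mxrep h' t' e' x'.
Proof.
split=> [j j'|a].
  have [->|ne] := eqVneq j i; have [->|ne'] := eqVneq j' i; rewrite ?eqxx ?e'i ?e'E //;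
    rewrite mulmx_block !(mulmx0, mul0mx, addr0, add0r) ?eKK //.
  - by rewrite block_mx0.
  - by rewrite (negPf ne) block_mx0.
  - by rewrite repx.1; case: eqP => // _; rewrite block_mx0.
rewrite /h' /t' /x'; case: ifP => ha.
  rewrite e'i e'E // !mulmx_block !(mulmx0, mul0mx, addr0, add0r).
  by rewrite !mulmxA eKK eer.
by rewrite !e'E ?ha // !mulmx_block !(mulmx0, mul0mx, addr0, add0r) repx.2.
Qed.

Lemma reflect_mxindec : mxindec e' x'.
Proof.
move=> f; rewrite -[f]submxK; set f1 := ulsubmx f; set f2 := ursubmx f.
set f3 := dlsubmx f; set f4 := drsubmx f; rewrite /mxendo sum_e' => -[+ fe fx ff].
rewrite mulmx_block !(mulmx0, mul0mx, addr0, add0r).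
move=> /eq_block_mx[f1E f2K f3E f4K].
have := fe i; rewrite e'i !mulmx_block !(mulmx0, mul0mx, addr0, add0r).
move=> /eq_block_mx[_ f2K0 Kf30 f4Kc].
have f20 : f2 = 0 by rewrite -f2K f2K0.
have fej j : j != i -> f1 *m e j = e j *m f1 /\ f3 *m e j = 0.
  move=> ne; have := fe j; rewrite e'E // !mulmx_block !(mulmx0, mul0mx, addr0, add0r).
  by case/eq_block_mx.
have f30 : f3 = 0 by rewrite -f3E mulmx_sumr big1 // => j /fej[].
rewrite f20 f30 in fe fx ff *.
have := ff; rewrite mulmx_block !(mulmx0, mul0mx, addr0, add0r).
move=> /eq_block_mx[f11 _ _ _].
have [|j ne||||a ha|a ha|[-> ->]|[-> ->]] := @reflect_endo f1 f4.
- exact: f1E.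
- exact: (fej j ne).1.
- exact: f4K.
- by rewrite -f4Kc.
- exact: f11.
- have := fx a; rewrite /x' (negPf ha) !mulmx_block !(mulmx0, mul0mx, addr0, add0r).
  by case/eq_block_mx.
- have := fx a; rewrite /x' ha !mulmx_block !(mulmx0, mul0mx, addr0, add0r).
  by case/eq_block_mx.
- by left; rewrite block_mx0.
- by right.
Qed.

Lemma reflect_exists : exists n' (e' : V -> 'M[k]_n') (x' : A -> 'M[k]_n'),
  [/\ is_mxrep (fun a => if h a == i then t a else h a)
               (fun a => if h a == i then i else t a) e' x',
      mxindec e' x', (forall j, j != i -> \rank (e' j) = \rank (e j))
    & (\rank (e' i) + \rank (e i) = \sum_(a | h a == i) \rank (e (t a)))%N].
Proof.
exists (n + #|{: A * 'I_n}|)%N, e', x'; split; [exact: reflect_mxrep | exact: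
  @reflect_mxindec | |].
  by move=> j ne; rewrite e'E // block_mxEv row_mx0 rank_col_mx0 rank_row_mx0.
by rewrite e'i block_mxEv row_mx0 rank_col_0mx rank_row_0mx rank_eK.
Qed.

End Reflection.

(** The reflection functor at a sink [i], which replaces the space at [i] by
    the kernel of the incoming map and reverses the arrows into [i]. *)
Theorem mxrep_reflect (k : fieldType) (V A : finType) (h t : A -> V) (i : V) n
    (e : V -> 'M[k]_n) (x : A -> 'M[k]_n) :
  is_mxrep h t e x -> mxindec e x -> (forall a, t a != i) ->
  (forall j, j != i -> \rank (e j) = 0%N) \/
  exists n' (e' : V -> 'M[k]_n') (x' : A -> 'M[k]_n'),
    [/\ is_mxrep (fun a => if h a == i then t a else h a)
                  (fun a => if h a == i then i else t a) e' x',
        mxindec e' x', (forall j, j != i -> \rank (e' j) = \rank (e j))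
      & (\rank (e' i) + \rank (e i) = \sum_(a | h a == i) \rank (e (t a)))%N].
Proof.
move=> repx indx sink; have [simple|[Psi [P1 P2 P3]]] := sink_split repx indx sink.
  by left.
right. exact (reflect_exists repx indx sink P1 P2 P3).
Qed.

(** * Kac's bound on the Tits form *)

Section Tits.
Variables (V A : finType).

(** The quadratic form of [euler_form], on natural dimension vectors. *)
Definition tits (h t : A -> V) (d : V -> nat) : int :=
  \sum_i (d i)%:Z * (d i)%:Z - \sum_a (d (t a))%:Z * (d (h a))%:Z.

Definition neighbour_dim (h t : A -> V) (d : V -> nat) i : nat :=
  (\sum_(a | h a == i) d (t a) + \sum_(a | t a == i) d (h a))%N.

Lemma tits_flip h t h' t' d :
  (forall a, (h' a = h a /\ t' a = t a) \/ (h' a = t a /\ t' a = h a)) ->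
  tits h' t' d = tits h t d.
Proof.
move=> flip; congr (_ - _); apply: eq_bigr => a _.
by case: (flip a) => [[-> ->]|[-> ->]] //; rewrite mulrC.
Qed.

Lemma tits_at h t d i : (forall a, t a != h a) ->
  tits h t d = (d i)%:Z * (d i)%:Z - (d i)%:Z * (neighbour_dim h t d i)%:Z +
    (\sum_(j | j != i) (d j)%:Z * (d j)%:Z
     - \sum_(a | (h a != i) && (t a != i)) (d (t a))%:Z * (d (h a))%:Z).
Proof.
move=> loopless; rewrite /tits (bigD1 i) //=.
rewrite (bigID (fun a => h a == i)) [X in _ - (_ + X)](bigID (fun a => t a == i)) /=.
have -> : \sum_(a | h a == i) (d (t a))%:Z * (d (h a))%:Z =
          (d i)%:Z * (\sum_(a | h a == i) d (t a))%N%:Z.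
  rewrite (big_morph Posz PoszD (erefl _)) mulr_sumr; apply: eq_bigr => a /eqP ->.
  by rewrite mulrC.
have -> : \sum_(a | (h a != i) && (t a == i)) (d (t a))%:Z * (d (h a))%:Z =
          (d i)%:Z * (\sum_(a | t a == i) d (h a))%N%:Z.
  rewrite (big_morph Posz PoszD (erefl _)) mulr_sumr; apply: eq_big => [a|a /andP[_
    /eqP->]] //.
  by case: (t a =P i) => [ta|_]; rewrite ?andbF // andbT -ta eq_sym loopless.
rewrite /neighbour_dim PoszD; ring.
Qed.

Lemma tits_neighbour_dim h t d :
  2 * tits h t d = \sum_i (d i)%:Z * (2 * (d i)%:Z - (neighbour_dim h t d i)%:Z).
Proof.
have sumE (f g : A -> V) : \sum_a (d (g a))%:Z * (d (f a))%:Z =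
    \sum_i (d i)%:Z * (\sum_(a | f a == i) d (g a))%N%:Z.
  rewrite (partition_big f xpredT) //=; apply: eq_bigr => i _.
  rewrite (big_morph Posz PoszD (erefl _)) mulr_sumr; apply: eq_bigr => a /eqP->.
  by rewrite mulrC.
have -> : \sum_i (d i)%:Z * (2 * (d i)%:Z - (neighbour_dim h t d i)%:Z) =
    2 * \sum_i (d i)%:Z * (d i)%:Z - \sum_a (d (t a))%:Z * (d (h a))%:Z
      - \sum_a (d (h a))%:Z * (d (t a))%:Z.
  rewrite (sumE h t) (sumE t h) mulr_sumr -!sumrB; apply: eq_bigr => i _.
  rewrite /neighbour_dim PoszD; ring.
have -> : \sum_a (d (h a))%:Z * (d (t a))%:Z = \sum_a (d (t a))%:Z * (d (h a))%:Z.
  by apply: eq_bigr => a _; rewrite mulrC.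
rewrite /tits; ring.
Qed.

Lemma neighbour_dim_off h t d d' i : (forall a, t a != h a) ->
  (forall j, j != i -> d' j = d j) -> neighbour_dim h t d' i = neighbour_dim h t d i.
Proof.
move=> loopless eq_d; congr (_ + _)%N; apply: eq_bigr => a /eqP ai; apply: eq_d.
  by rewrite -ai.
by rewrite -ai eq_sym.
Qed.

(** [c] and [D - c] have the same value of [c * c - c * D]. *)
Lemma tits_reflect h t d d' i : (forall a, t a != h a) ->
  (forall j, j != i -> d' j = d j) -> (d' i + d i = neighbour_dim h t d i)%N ->
  tits h t d' = tits h t d.
Proof.
move=> loopless eq_d di; rewrite !(@tits_at h t _ i) // (neighbour_dim_off loopless eq_d)
  -di.
congr (_ + (_ - _)); last 2 first.
- by apply: eq_bigr => j ne; rewrite eq_d.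
- by apply: eq_bigr => a /andP[ha ta]; rewrite !eq_d.
rewrite PoszD; ring.
Qed.

End Tits.

Lemma prime_above_nonchar (k : fieldType) B :
  exists l, [/\ prime l, (B < l)%N & l%:R != 0 :> k].
Proof.
have [l1 B1 p1] := prime_above B; have [l2 l12 p2] := prime_above l1.
have [e1|] := eqVneq (l1%:R : k) 0; last by exists l1.
exists l2; split=> //; first exact: ltn_trans l12.
apply/negP => /eqP e2; have c1 : l1 \in [pchar k] by apply/andP; split=> //; apply/eqP.
have : l2 \in [pchar k] by apply/andP; split=> //; apply/eqP.
by rewrite (pcharf_eq c1) inE => /eqP e12; rewrite e12 ltnn in l12.
Qed.

(** Kac's bound. A vertex [i] with [neighbour_dim < 2 * d i] is turned into a
    sink by passing to a finite field and reorienting; the reflection at [i] then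
    preserves the form and lowers the total dimension. The field changes at each
    step, as the prime [l] depends on the dimension vector. *)
Theorem mxindec_tits_le1 (k : fieldType) (V A : finType) (h t : A -> V) n
    (e : V -> 'M[k]_n) (x : A -> 'M[k]_n) :
  (forall a, t a != h a) -> is_mxrep h t e x -> mxindec e x ->
  primitive_dim (fun i => \rank (e i)) -> tits h t (fun i => \rank (e i)) <= 1.
Proof.
have [m] := ubnP (\sum_i \rank (e i)).
elim: m => // m IHm in k h t n e x *; move=> le_m loopless repx indx prim.
set d := fun i => \rank (e i) in prim *.
case: (classic (exists i, (neighbour_dim h t d i < 2 * d i)%N)) => [[i lt_i]|fund]; last
  first.
  (* The dimension vector lies in the fundamental region. *)
  suff : 2 * tits h t d <= 0 by lia.
  rewrite tits_neighbour_dim; apply: sumr_le0 => i _; apply: mulr_ge0_le0 => //.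
  rewrite subr_le0 -PoszM lez_nat leqNgt; apply/negP => lt_i; apply: fund.
  by exists i.
have [n1 [e1 [x1 [rep1 ind1 sum1 rk1]]]] := mxrep_compress repx indx.
have prim1 : primitive_dim (fun i => \rank (e1 i)).
  by move=> c cd; apply: prim => j; have := cd j; rewrite rk1.
have [B BP] := generic_weights prim; have [l [pr_l ltB l0]] := prime_above_nonchar k B.
have [w [w_dim w_gen]] := BP l pr_l ltB.
have [F [e2 [x2 [rep2 ind2 sum2 rk2 [z pz]]]]] := mxrep_specialize rep1 ind1 sum1 prim1
  pr_l l0.
have rk j : \rank (e2 j) = d j by rewrite rk2 rk1.
pose h3 a := if t a == i then t a else h a; pose t3 a := if t a == i then h a else t a.
have flip3 a : (h3 a = h a /\ t3 a = t a) \/ (h3 a = t a /\ t3 a = h a).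
  by rewrite /h3 /t3; case: eqP => _; [right|left].
have [x3 [rep3 ind3]] : exists x3, is_mxrep h3 t3 e2 x3 /\ mxindec e2 x3.
  apply: (@mxindec_reorient F V A n1 e2 rep2.1 sum2 l z w pr_l pz _ _ _ h t h3 t3 x2) => //.
  - by under eq_bigr do rewrite rk.
  - move=> c cd dvd_c; have [|c0|c1] := w_gen c _ dvd_c; first by move=> j; rewrite -rk.
      by left.
    by right=> j; rewrite rk.
  - by move=> c cd; apply: prim => j; have := cd j; rewrite rk.
have sink a : t3 a != i.
  by rewrite /t3; case: (t a =P i) => [ta|/eqP //]; rewrite -ta eq_sym.
have sumN : (\sum_(a | h3 a == i) d (t3 a) = neighbour_dim h t d i)%N.
  rewrite (bigID (fun a => t a == i)) /= addnC; congr (_ + _)%N.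
    apply: eq_big => a; rewrite /h3 /t3.
      case: (t a =P i) => [ta|_]; rewrite ?andbT ?andbF // -ta.
      by apply/esym/negbTE; rewrite eq_sym loopless.
    by case/andP => _ /negPf ->.
  apply: eq_big => a; rewrite /h3 /t3; first by case: (t a =P i) => [ta|_]; rewrite
    ?andbF // ta eqxx.
  by case/andP => _ ->.
case: (mxrep_reflect rep3 ind3 sink) => [simple|].
  have dj j : j != i -> d j = 0%N by move=> ne; rewrite -rk simple.
  have di : d i = 1%N.
    apply: prim => j; have [->|ne] := eqVneq j i; first exact: dvdnn.
    by rewrite (dj j ne) dvdn0.
  rewrite (@tits_at _ _ h t d i loopless) di.
  have -> : \sum_(j | j != i) (d j)%:Z * (d j)%:Z = 0.
    by rewrite big1 // => j /dj ->; rewrite mul0r.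
  have -> : \sum_(a | (h a != i) && (t a != i)) (d (t a))%:Z * (d (h a))%:Z = 0.
    by rewrite big1 // => a /andP[_ /dj ->]; rewrite mul0r.
  lia.
case=> n4 [e4 [x4 [rep4 ind4 rk4 rki]]].
set h4 := fun a => _ in rep4; set t4 := fun a => _ in rep4.
have flip4 a : (h4 a = h3 a /\ t4 a = t3 a) \/ (h4 a = t3 a /\ t4 a = h3 a).
  by rewrite /h4 /t4; case: eqP => [->|_]; [right|left].
pose d4 j := \rank (e4 j).
have d4j j : j != i -> d4 j = d j by move=> ne; rewrite /d4 rk4.
have d4i : (d4 i + d i = neighbour_dim h t d i)%N.
  by rewrite -sumN -(rk i) /d4 rki; apply: eq_bigr => a _; rewrite rk.
rewrite -(tits_reflect loopless d4j d4i) -(tits_flip _ flip3) -(tits_flip _ flip4).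
apply: (IHm F h4 t4 n4 e4 x4) => //.
- have lt_d : (d4 i < d i)%N by move: lt_i d4i; lia.
  apply: (@leq_trans (\sum_j d j)); last by rewrite -ltnS.
  rewrite (bigD1 i) //= [X in (_ < X)%N](bigD1 i) //=.
  by rewrite (eq_bigr d) ?ltn_add2r // => j /d4j.
- move=> a; have : t3 a != h3 a by case: (flip3 a) => [[-> ->] //|[-> ->]]; rewrite eq_sym.
  by case: (flip4 a) => [[-> ->] //|[-> ->]]; rewrite eq_sym.
- move=> c cd; apply: prim => j; have [->|ne] := eqVneq j i; last by rewrite -d4j //;
  apply: cd.
  rewrite -(dvdn_addr _ (cd i)) -/(d4 i) d4i /neighbour_dim.
  rewrite dvdn_add // dvdn_sum // => a /eqP ai; rewrite -d4j //; first exact: cd.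
    by rewrite -ai.
  exact: cd.
  by rewrite -ai eq_sym.
Qed.

(** * Splitting a vertex at an image *)

Lemma big_option (R : zmodType) (T : finType) (F : option T -> R) :
  \sum_o F o = F None + \sum_a F (Some a).
Proof.
rewrite (bigD1 None) //=; congr (_ + _).
rewrite (reindex_omap Some id) => [|[]] //=.
by apply: eq_bigl => a; rewrite eqxx.
Qed.

Lemma tits1_primitive (V A : finType) (h t : A -> V) (d : V -> nat) :
  tits h t d = 1 -> primitive_dim d.
Proof.
move=> tits1 m md; have dvd_t : (m%:Z * m%:Z %| tits h t d)%Z.
  by apply: rpredB; apply: rpred_sum => j _; apply: dvdz_mul; rewrite dvdzE /= md.
move: dvd_t; rewrite tits1 -PoszM dvdz1 /= => /eqP.
by case: m {md} => [|[|m]].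
Qed.

Section Split.
Variables (k : fieldType) (V A : finType) (h t : A -> V) (i : V) (n : nat).
Variables (e : V -> 'M[k]_n) (x : A -> 'M[k]_n) (B : {set A}).
Hypothesis repx : is_mxrep h t e x.
Hypothesis indx : mxindec e x.
Hypothesis head_B : forall a, a \in B -> h a = i.

Let S := (\sum_(a in B) x a)%MS.
Let im := pinvmx S *m S.

Let Sim : S *m im = S. Proof. by rewrite mulmxA mulmxKpV. Qed.

Let im_im : im *m im = im. Proof. by rewrite {1}/im -mulmxA Sim. Qed.

Let im_e : im *m e i = im.
Proof.
have /submxP[D eqS] : (S <= e i)%MS.
  apply/sumsmx_subP => a aB; apply/submxP; exists (x a).
  by rewrite -(head_B aB) (mxrep_head repx).
by rewrite /im -mulmxA eqS -(mulmxA D) (mxrep_idem repx).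
Qed.

Let x_im a : a \in B -> x a *m im = x a.
Proof.
move=> aB; have /submxP[D ->] : (x a <= S)%MS by apply: sumsmx_sup (submx_refl _).
by rewrite -mulmxA Sim.
Qed.

Let rank_im : \rank im = \rank S.
Proof.
apply/eqP; rewrite eqn_leq mxrankM_maxr -{1}Sim.
exact: mxrankM_maxr.
Qed.

(** The image of the arrows in [B] becomes the space at a new vertex [None]; they
    now end there, and the new arrow [None] is the inclusion into [V_i]. *)
Let e' o : 'M[k]_(n + n) :=
  if o is Some j then block_mx (e j) 0 0 0 else block_mx 0 0 0 im.
Let x' o : 'M[k]_(n + n) :=
  if o is Some a then if a \in B then block_mx 0 (x a) 0 0 else block_mx (x a) 0 0 0
  else block_mx 0 0 im 0.
Let h' o := if o is Some a then if a \in B then None else Some (h a) else Some i.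
Let t' (o : option A) := if o is Some a then Some (t a) else None.

Let sum_e' : \sum_o e' o = block_mx (\sum_j e j) 0 0 im.
Proof.
have blk0 : block_mx 0 0 0 0 = 0 :> 'M[k]_(n + n) by rewrite block_mx0.
have blkD : {morph (fun y => block_mx y 0 0 0 : 'M[k]_(n + n)) : y z / y + z}.
  by move=> y z; rewrite add_block_mx !addr0.
by rewrite big_option /= -(big_morph _ blkD blk0) add_block_mx !(addr0, add0r).
Qed.

Lemma split_mxrep : is_mxrep h' t' e' x'.
Proof.
split=> [[j|] [j'|]|[a|]] /=.
- rewrite mulmx_block !(mulmx0, mul0mx, addr0, add0r) repx.1.
  by rewrite (inj_eq (@Some_inj _)); case: eqP => // _; rewrite block_mx0.
- by rewrite mulmx_block !(mulmx0, mul0mx, addr0, add0r) block_mx0.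
- by rewrite mulmx_block !(mulmx0, mul0mx, addr0, add0r) block_mx0.
- by rewrite mulmx_block !(mulmx0, mul0mx, addr0, add0r) im_im.
- case: ifP => aB; rewrite !mulmx_block !(mulmx0, mul0mx, addr0, add0r) ?repx.2 //.
  by rewrite (mxrep_tail repx) x_im.
- by rewrite !mulmx_block !(mulmx0, mul0mx, addr0, add0r) im_im im_e.
Qed.

Lemma split_mxindec : mxindec e' x'.
Proof.
move=> f; rewrite -[f]submxK; set f1 := ulsubmx f; set f2 := ursubmx f.
set f3 := dlsubmx f; set f4 := drsubmx f; rewrite /mxendo sum_e' => -[+ fe fx ff].
rewrite mulmx_block !(mulmx0, mul0mx, addr0, add0r) => /eq_block_mx[f1E f2K f3E f4K].
have := fe None; rewrite /= !mulmx_block !(mulmx0, mul0mx, addr0, add0r).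
move=> /eq_block_mx[_ f2K0 _ _].
have f20 : f2 = 0 by rewrite -f2K f2K0.
have fej j : f1 *m e j = e j *m f1 /\ f3 *m e j = 0.
  have := fe (Some j); rewrite /= !mulmx_block !(mulmx0, mul0mx, addr0, add0r).
  by case/eq_block_mx.
have f30 : f3 = 0 by rewrite -f3E mulmx_sumr big1 // => j _; case: (fej j).
rewrite f20 f30 in fe fx ff *.
have := ff; rewrite mulmx_block !(mulmx0, mul0mx, addr0, add0r) => /eq_block_mx[f11 _ _ _].
have := fx None; rewrite /= !mulmx_block !(mulmx0, mul0mx, addr0, add0r).
rewrite f4K => /eq_block_mx[_ _ f4E _].
have f1x a : f1 *m x a = x a *m f1.
  have := fx (Some a); rewrite /=; case: ifP => aB;
    rewrite !mulmx_block !(mulmx0, mul0mx, addr0, add0r) => /eq_block_mx[] //.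
  by move=> _ -> _ _; rewrite f4E mulmxA x_im.
have [||f10|f1E'] := @indx f1.
- by split=> // j; case: (fej j).
- exact: f11.
- by left; rewrite f4E f10 mulmx0 block_mx0.
- right; rewrite f4E f1E'; congr block_mx.
  by rewrite -[im in LHS]im_e -mulmxA (mxrep_suml repx) im_e.
Qed.

Lemma split_ranks o : \rank (e' o) = if o is Some j then \rank (e j) else \rank S.
Proof.
case: o => [j|] /=; first by rewrite block_mxEv row_mx0 rank_col_mx0 rank_row_mx0.
by rewrite block_mxEv row_mx0 rank_col_0mx rank_row_0mx rank_im.
Qed.

Lemma split_tits : tits h' t' (fun o => \rank (e' o)) =
  tits h t (fun j => \rank (e j)) +
  ((\sum_(a in B) \rank (e (t a)))%N%:Z - (\rank S)%:Z) * ((\rank (e i))%:Z - (\rank S)%:Z).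
Proof.
have -> : tits h' t' (fun o => \rank (e' o)) =
    tits h' t' (fun o => if o is Some j then \rank (e j) else \rank S).
  by congr (_ - _); apply: eq_bigr => o _; rewrite !split_ranks.
rewrite /tits !big_option /=.
rewrite (bigID (mem B)) [X in _ = _ - X + _](bigID (mem B)) /=.
have -> : \sum_(a in B) (\rank (e (t a)))%:Z *
    (match (if a \in B then None else Some (h a)) with Some j => \rank (e j) | None =>
      \rank S end)%:Z
    = (\sum_(a in B) \rank (e (t a)))%N%:Z * (\rank S)%:Z.
  rewrite (big_morph Posz PoszD (erefl _)) mulr_suml.
  by apply: eq_bigr => a ->.
have -> : \sum_(a in B) (\rank (e (t a)))%:Z * (\rank (e (h a)))%:Z
    = (\sum_(a in B) \rank (e (t a)))%N%:Z * (\rank (e i))%:Z.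
  rewrite (big_morph Posz PoszD (erefl _)) mulr_suml.
  by apply: eq_bigr => a aB; rewrite (head_B aB).
have -> : \sum_(a | a \notin B) (\rank (e (t a)))%:Z *
    (match (if a \in B then None else Some (h a)) with Some j => \rank (e j) | None =>
      \rank S end)%:Z
    = \sum_(a | a \notin B) (\rank (e (t a)))%:Z * (\rank (e (h a)))%:Z.
  by apply: eq_bigr => a /negPf->.
ring.
Qed.

Hypothesis loopless : forall a, t a != h a.

(** If the rank [r] were smaller than both dimensions [d] and [c], splitting off
    the image would give an indecomposable representation whose form takes the
    value [1 + (d - r) * (c - r)], against Kac's bound. *)
Theorem mxindec_max_rank : tits h t (fun j => \rank (e j)) = 1 ->
  \rank (\sum_(a in B) x a)%MS = minn (\sum_(a in B) \rank (e (t a)))%N (\rank (e i)).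
Proof.
move=> tits1; have prim := tits1_primitive tits1; rewrite -/S.
have le_i : (\rank S <= \rank (e i))%N.
  by rewrite -rank_im -im_e mxrankM_maxr.
have le_d : (\rank S <= \sum_(a in B) \rank (e (t a)))%N.
  apply: (big_ind2 (fun (M : 'M_n) r => \rank M <= r)%N) => [|M r M' r' leM leM'|a _].
  - by rewrite mxrank0.
  - exact: leq_trans (mxrank_adds_leqif _ _).1 (leq_add leM leM').
  - by rewrite -(mxrep_tail repx) mxrankM_maxl.
have : tits h' t' (fun o => \rank (e' o)) <= 1.
  apply: (@mxindec_tits_le1 _ _ _ h' t' _ e' x' _ split_mxrep split_mxindec).
    by case=> [a|] //=; case: ifP => // _; rewrite (inj_eq (@Some_inj _)).
  by move=> m md; apply: prim => j; have := md (Some j); rewrite split_ranks.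
rewrite split_tits tits1 gerDl; move: le_i le_d; rewrite -/S.
move: (\rank S) (\rank (e i)) (\sum_(a in B) _)%N => r c d; nia.
Qed.

End Split.

Section Transpose.
Variables (k : fieldType) (V A : finType) (h t : A -> V) (n : nat).
Variables (e : V -> 'M[k]_n) (x : A -> 'M[k]_n).

Lemma mxrep_tr : is_mxrep h t e x -> is_mxrep t h (fun i => (e i)^T) (fun a => (x a)^T).
Proof.
move=> repx; split=> [i j|a]; last by rewrite -!trmx_mul mulmxA repx.2.
by rewrite -trmx_mul repx.1 eq_sym; case: eqP => [->|_]; rewrite ?trmx0.
Qed.

Lemma mxindec_tr : is_mxrep h t e x -> mxindec e x ->
  mxindec (fun i => (e i)^T) (fun a => (x a)^T).
Proof.
move=> repx indx f; rewrite /mxendo.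
have -> : \sum_i (e i)^T = (\sum_i e i)^T by rewrite raddf_sum.
case=> fE fe fx ff.
have fe' i : f^T *m e i = e i *m f^T.
  by apply: trmx_inj; rewrite !trmx_mul trmxK fe.
have fE' : f^T *m \sum_i e i = f^T.
  rewrite mulmx_sumr; under eq_bigr do rewrite fe'.
  by rewrite -mulmx_suml -[_ *m _]trmxK trmx_mul trmxK fE.
have [||f0|f1] := indx f^T.
- split=> // a; by apply: trmx_inj; rewrite !trmx_mul trmxK fx.
- by rewrite -trmx_mul ff.
- by left; apply: trmx_inj; rewrite f0 trmx0.
- by right; apply: trmx_inj; rewrite f1 trmxK.
Qed.

End Transpose.

(** * From representations to matrices *)

Import VectorInternalTheory.
Local Notation head := Defs.head.

Lemma mul_f2mx (k : fieldType) (U W : vectType k) (f : 'Hom(U, W)) u :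
  u *m f2mx f = v2r (f (r2v u)).
Proof. by rewrite unlock /= r2vK r2vK. Qed.

Lemma rank_limg (k : fieldType) (U W : vectType k) (f : 'Hom(U, W)) :
  \dim (limg f) = \rank (f2mx f).
Proof.
have -> : limg f = mx2vs (vs2mx fullv *m f2mx f) by rewrite unlock.
rewrite /dimv mx2vsK; apply/eqP; rewrite eqn_leq mxrankM_maxr.
by rewrite mxrankS // -{1}[f2mx f]mul1mx submxMr // (mx2vsK 1%:M).
Qed.

Section RepMatrix.
Variables (k : fieldType) (Q : quiver) (X : rep k Q).

Definition arrow_mx (a : arrow Q) : 'M[k]_(dim (X (tail a)), dim (X (head a))) :=
  f2mx (rep_map X a).

Lemma mul_arrow_mx a v : v2r v *m arrow_mx a = v2r (rep_map X a v).
Proof. by rewrite mul_f2mx v2rK. Qed.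

Section Splitting.
Variable f : forall i, 'M[k]_(dim (X i)).

(** The image of [f], on row spaces: [row_base] includes it and [col_base]
    projects onto it. *)
Definition img_rep : rep k Q :=
  @Rep k Q (fun i => 'rV[k]_(\rank (f i)) : vectType k)
    (fun a => linfun (mulmxr (row_base (f (tail a)) *m arrow_mx a *m col_base (f (head
      a))))).

End Splitting.

Section Decomposition.
Variables f g : forall i, 'M[k]_(dim (X i)).

Definition split_fun i (v : X i) : img_rep f i * img_rep g i :=
  (v2r v *m col_base (f i), v2r v *m col_base (g i)).

Fact split_fun_linear i : linear (@split_fun i).
Proof. by move=> c u v; rewrite /split_fun linearP !mulmxDl -!scalemxAl. Qed.

HB.instance Definition _ i :=
  GRing.isLinear.Build k _ _ _ (@split_fun i) (@split_fun_linear i).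

Hypothesis ff : forall i, f i *m f i = f i.
Hypothesis gE : forall i, g i = 1%:M - f i.
Hypothesis fA : forall a, arrow_mx a *m f (head a) = f (tail a) *m arrow_mx a.

Let gg i : g i *m g i = g i.
Proof. by rewrite gE mulmxBr mulmx1 mulmxBl mul1mx ff subrr subr0. Qed.

Let gA a : arrow_mx a *m g (head a) = g (tail a) *m arrow_mx a.
Proof. by rewrite !gE mulmxBr mulmxBl mulmx1 mul1mx fA. Qed.

Let base_orth i (p q : 'M[k]_(dim (X i))) : p *m p = p -> q *m q = q -> p *m q = 0 ->
  row_base p *m col_base q = 0.
Proof.
move=> pp qq pq; have := idempotent_base pp; have := idempotent_base qq.
have := mulmx_base p; have := mulmx_base q.
move: (\rank p) (\rank q) (row_base p) (col_base p) (row_base q) (col_base q).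
move=> r s Rp Cp Rq Cq Eq Ep RCq RCp.
rewrite -[LHS]mul1mx -RCp -[X in X = _]mulmx1 -RCq -!mulmxA (mulmxA Cq) Eq.
by rewrite (mulmxA Cp) (mulmxA (Cp *m Rp)) Ep pq mul0mx mulmx0.
Qed.

Lemma rep_split_isomorphic : isomorphic X (rep_sum (img_rep f) (img_rep g)).
Proof.
exists (fun i => linfun (@split_fun i)); split=> [i|a v]; last first.
  rewrite !lfunE /= /split_fun /rep_sum_fun /= !lfunE /= -!mul_arrow_mx.
  have step (p : forall i, 'M[k]_(dim (X i))) :
      arrow_mx a *m p (head a) = p (tail a) *m arrow_mx a ->
      p (head a) *m p (head a) = p (head a) ->
      v2r v *m arrow_mx a *m col_base (p (head a)) =
      v2r v *m col_base (p (tail a)) *m (row_base (p (tail a)) *m arrow_mx a *m col_base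
        (p (head a))).
    move=> pA pp; have pC : p (head a) *m col_base (p (head a)) = col_base (p (head a)).
      by rewrite -[X in X *m _]mulmx_base -mulmxA idempotent_base // mulmx1.
    move: (mulmx_base (p (tail a))) pC pA.
    move: (row_base (p (tail a))) (col_base (p (tail a))) (col_base (p (head a))).
    move: (p (tail a)) (p (head a)) => pt ph {pp}.
    move: (\rank pt) (\rank ph) => rt rh Rt Ct Ch CR pC pA.
    by rewrite !mulmxA -(mulmxA _ Ct Rt) CR -(mulmxA _ pt) -pA -!mulmxA pC.
  by congr (_, _); apply: step.
pose inv (w : img_rep f i * img_rep g i) : X i :=
  r2v (w.1 *m row_base (f i) + w.2 *m row_base (g i)).
have fg : f i *m g i = 0 by rewrite gE mulmxBr mulmx1 ff subrr.
have gf : g i *m f i = 0 by rewrite gE mulmxBl mul1mx ff subrr.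
exists inv => [v|[y z]]; rewrite lfunE /= /inv /split_fun /=.
  by rewrite -!(mulmxA (v2r v) (col_base _)) !mulmx_base -mulmxDr gE addrC subrK mulmx1
    v2rK.
rewrite r2vK !mulmxDl -!(mulmxA y (row_base _)) -!(mulmxA z (row_base _)).
rewrite !idempotent_base // !base_orth //.
by rewrite !mulmx0 addr0 add0r !mulmx1.
Qed.

End Decomposition.

Lemma indecomposable_idempotent (f : forall i, 'M[k]_(dim (X i))) :
  indecomposable X -> (forall i, f i *m f i = f i) ->
  (forall a, arrow_mx a *m f (head a) = f (tail a) *m arrow_mx a) ->
  (forall i, f i = 0) \/ (forall i, f i = 1%:M).
Proof.
move=> [_ ind] ff fA; pose g i := 1%:M - f i.
have zeroP (p : forall i, 'M[k]_(dim (X i))) : zero_rep (img_rep p) -> forall i, p i = 0.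
  by move=> pz i; apply/eqP; rewrite -mxrank_eq0; have := pz i; rewrite dimvf /= /dim /=
    mul1n => ->.
have [/zeroP f0|/zeroP g0] := ind _ _ (rep_split_isomorphic ff (fun i => erefl (g i)) fA).
  by left.
by right=> i; apply/esym/eqP; rewrite -subr_eq0 -/(g i) g0.
Qed.

Let I := {i : vertex Q & 'I_(dim (X i))}.

(** The inclusion of the space at [i] into the sum of all of them, whose
    coordinates are the pairs of a vertex and a coordinate there. *)
Definition vertex_mx i : 'M[k]_(dim (X i), #|{: I}|) :=
  \matrix_(u, w) (enum_val w == Tagged (fun i => 'I_(dim (X i))) u)%:R.

Lemma vertex_mxK i : vertex_mx i *m (vertex_mx i)^T = 1%:M.
Proof.
apply/matrixP => u v; rewrite !mxE.
pose T := Tagged (fun i => 'I_(dim (X i))).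
rewrite (bigD1 (enum_rank (T i u))) //= !mxE enum_rankK eqxx mul1r eq_Tagged /=.
rewrite big1 ?addr0 // => w ne; rewrite !mxE (_ : (enum_val w == _) = false) ?mul0r //.
by apply: contraNF ne => /eqP eq_w; rewrite -(enum_valK w) eq_w.
Qed.

Lemma vertex_mx_orth i j : i != j -> vertex_mx i *m (vertex_mx j)^T = 0.
Proof.
move=> ne; apply/matrixP => u v; rewrite !mxE big1 // => w _; rewrite !mxE.
case: eqP => [->|_]; last by rewrite mul0r.
rewrite mul1r (_ : (_ == _) = false) //.
by apply: contraNF ne => /eqP/(congr1 tag) /= ->.
Qed.

Definition vertex_proj i := (vertex_mx i)^T *m vertex_mx i.
Definition arrow_proj a := (vertex_mx (tail a))^T *m arrow_mx a *m vertex_mx (head a).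

Lemma vertex_projK i : vertex_mx i *m vertex_proj i = vertex_mx i.
Proof. by rewrite mulmxA vertex_mxK mul1mx. Qed.

Lemma rep_mxrep : is_mxrep (@Defs.head Q) (@tail Q) vertex_proj arrow_proj.
Proof.
split=> [i j|a].
  case: eqP => [<-|/eqP ne]; rewrite /vertex_proj !mulmxA -(mulmxA _ (vertex_mx i)).
    by rewrite vertex_mxK mulmx1.
  by rewrite vertex_mx_orth // mulmx0 mul0mx.
rewrite /arrow_proj !mulmxA -(mulmxA _ (vertex_mx (tail a))) vertex_mxK mulmx1.
by rewrite -!mulmxA vertex_projK.
Qed.

Lemma rank_vertex_proj i : \rank (vertex_proj i) = dim (X i).
Proof. by rewrite rank_retract // vertex_mxK. Qed.

Lemma rep_mxindec : indecomposable X -> mxindec vertex_proj arrow_proj.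
Proof.
move=> ind F [FE Fe Fx] FF; pose f i := vertex_mx i *m F *m (vertex_mx i)^T.
have eF i : vertex_mx i *m F *m vertex_proj i = vertex_mx i *m F.
  by rewrite -mulmxA Fe mulmxA vertex_projK.
have FV i : F *m (vertex_mx i)^T = vertex_proj i *m F *m (vertex_mx i)^T.
  by rewrite -Fe -mulmxA -[vertex_proj i *m _]mulmxA vertex_mxK mulmx1.
have ff i : f i *m f i = f i.
  by rewrite /f !mulmxA -(mulmxA (vertex_mx i *m F)) eF -(mulmxA _ F F) FF.
have fA a : arrow_mx a *m f (head a) = f (tail a) *m arrow_mx a.
  have := congr1 (fun M => vertex_mx (tail a) *m M *m (vertex_mx (head a))^T) (Fx a).
  rewrite /= /arrow_proj !mulmxA vertex_mxK mul1mx => <-.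
  by rewrite -(mulmxA _ (vertex_mx (head a))) vertex_mxK mulmx1.
have Fsum : F = \sum_i (vertex_mx i)^T *m f i *m vertex_mx i.
  rewrite -{1}FE mulmx_sumr; apply: eq_bigr => i _.
  by rewrite /f !mulmxA -/(vertex_proj i) -FV.
have [f0|f1] := indecomposable_idempotent ind ff fA; [left|right]; rewrite Fsum.
  by rewrite big1 // => i _; rewrite f0 mulmx0 mul0mx.
by apply: eq_bigr => i _; rewrite f1 mulmx1.
Qed.

End RepMatrix.

(** * Maximal rank *)

Section DirsumMatrix.
Variables (k : fieldType) (I : finType) (V : I -> vectType k).

Definition dirsum_proj b (v : dirsum V) : V b := dirsum_fun v b.
Definition dirsum_inj b (y : V b) : dirsum V := dirsum_mk (fun j => dfwith (fun i => 0 :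
  V i) y j).

Fact dirsum_proj_linear b : linear (@dirsum_proj b).
Proof. by move=> c u v; rewrite /dirsum_proj dirsum_funP. Qed.

Fact dirsum_inj_linear b : linear (@dirsum_inj b).
Proof.
move=> c u v; apply/dirsumP => j; rewrite dirsum_funP !dirsumE.
have [->|ne] := eqVneq j b; first by rewrite !dfwith_in.
by rewrite !dfwith_out 1?eq_sym // scaler0 addr0.
Qed.

HB.instance Definition _ b :=
  GRing.isLinear.Build k _ _ _ (@dirsum_proj b) (@dirsum_proj_linear b).
HB.instance Definition _ b :=
  GRing.isLinear.Build k _ _ _ (@dirsum_inj b) (@dirsum_inj_linear b).

Lemma dirsum_injK b y : dirsum_fun (@dirsum_inj b y) b = y.
Proof. by rewrite dirsumE dfwith_in. Qed.

Lemma dirsum_inj0 b y c : c != b -> dirsum_fun (@dirsum_inj b y) c = 0.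
Proof. by move=> ne; rewrite dirsumE dfwith_out // eq_sym. Qed.

Lemma dirsum_sum v : v = \sum_b dirsum_inj (dirsum_fun v b).
Proof.
apply/dirsumP => c; rewrite -[RHS]/(dirsum_proj c _) linear_sum (bigD1 c) //= big1.
  by rewrite addr0 /dirsum_proj dirsum_injK.
by move=> b ne; rewrite /dirsum_proj dirsum_inj0 // eq_sym.
Qed.

Lemma dim_dirsum : \dim {: dirsum V} = (\sum_b dim (V b))%N.
Proof. by rewrite dimvf [RHS]big_enum_val. Qed.

Definition proj_mx b := f2mx (linfun (@dirsum_proj b)).
Definition inj_mx b := f2mx (linfun (@dirsum_inj b)).

Lemma mul_proj_mx b u : u *m proj_mx b = v2r (dirsum_fun (r2v u) b).
Proof. by rewrite mul_f2mx lfunE. Qed.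

Lemma mul_inj_mx b u : u *m inj_mx b = v2r (dirsum_inj (r2v u)).
Proof. by rewrite mul_f2mx lfunE. Qed.

End DirsumMatrix.

Lemma eq_mul_row (R : pzSemiRingType) m n (M N : 'M[R]_(m, n)) :
  (forall u : 'rV_m, u *m M = u *m N) -> M = N.
Proof. by move=> eqMN; apply/row_matrixP => i; rewrite !rowE. Qed.

Section MaxRank.
Variables (k : fieldType) (Q : quiver) (X : rep k Q).

Let Rv i := vertex_mx X i.
Let xx a := arrow_proj X a.

Let RvK i : Rv i *m (Rv i)^T = 1%:M. Proof. exact: vertex_mxK. Qed.

Let rank_RvM m i (M : 'M_(m, _)) : \rank (M *m Rv i) = \rank M.
Proof. by apply: mxrankMfree; apply/row_freeP; exists (Rv i)^T. Qed.

Let tail_xx a : (Rv (tail a))^T *m (Rv (tail a) *m xx a) = xx a.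
Proof. by rewrite mulmxA (mxrep_tail (rep_mxrep X)). Qed.

Let map_to_mx a i (e : head a = i) : f2mx (map_to X e) *m Rv i = Rv (tail a) *m xx a.
Proof. by case: _ / e; rewrite /xx /arrow_proj !mulmxA RvK mul1mx. Qed.

Let map_from_mx a i (e : tail a = i) : f2mx (map_from X e) *m Rv (head a) = Rv i *m xx a.
Proof. by case: _ / e; rewrite /xx /arrow_proj !mulmxA RvK mul1mx. Qed.

Lemma rank_in_fun i (A : {set arrow Q}) (sA : A \subset arrows_in i) :
  \dim (limg (linfun (@in_fun k Q X i A sA))) = \rank (\sum_(a in A) xx a)%MS.
Proof.
set f := linfun _; rewrite rank_limg -(rank_RvM _).
pose U (a : {a | a \in A}) : vectType k := X (tail (val a)).
pose M (a : {a | a \in A}) := f2mx (map_to X (head_in sA a)).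
have fE : f2mx f = \sum_a proj_mx U a *m M a.
  apply: eq_mul_row => u; rewrite mul_f2mx lfunE /= /in_fun linear_sum mulmx_sumr.
  by apply: eq_bigr => a _; rewrite mulmxA mul_proj_mx mul_f2mx v2rK.
have ME a : M a = inj_mx U a *m f2mx f.
  apply: eq_mul_row => u; rewrite mulmxA (@mul_inj_mx _ _ U a u) !mul_f2mx v2rK lfunE /=
    /in_fun.
  rewrite (bigD1 a) //= dirsum_injK big1 ?addr0 // => b ne.
  by rewrite dirsum_inj0 // linear0.
apply/eqP; rewrite eqn_leq !mxrankS //.
  apply/sumsmx_subP => a aA; rewrite -tail_xx.
  rewrite -(map_to_mx (head_in sA (exist _ a aA))) -/(M (exist _ a aA)) ME.
  by apply/submxP; exists ((Rv (tail a))^T *m inj_mx U (exist _ a aA)); rewrite !mulmxA.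
rewrite fE mulmx_suml summx_sub // => a _; rewrite -mulmxA map_to_mx mulmxA.
by apply: submx_trans (submxMl _ _) (sumsmx_sup (val a) (valP a) _).
Qed.

Lemma rank_out_fun i (B : {set arrow Q}) (sB : B \subset arrows_out i) :
  \dim (limg (linfun (@out_fun k Q X i B sB))) = \rank (\sum_(b in B) (xx b)^T)%MS.
Proof.
set f := linfun _; rewrite rank_limg -mxrank_tr -(rank_RvM _).
pose U (b : {b | b \in B}) : vectType k := X (head (val b)).
pose M (b : {b | b \in B}) := f2mx (map_from X (tail_out sB b)).
have fE : f2mx f = \sum_b M b *m inj_mx U b.
  apply: eq_mul_row => u; rewrite mul_f2mx lfunE /= [Y in v2r Y]dirsum_sum.
  rewrite linear_sum mulmx_sumr; apply: eq_bigr => b _.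
  by rewrite mulmxA (@mul_inj_mx _ _ U b) mul_f2mx v2rK dirsumE.
have ME b : M b = f2mx f *m proj_mx U b.
  by apply: eq_mul_row => u; rewrite mulmxA mul_proj_mx !mul_f2mx v2rK lfunE /= dirsumE.
have xM (b : {b | b \in B}) : (xx (val b))^T = (Rv (head (val b)))^T *m (M b)^T *m Rv i.
  rewrite -[Rv i in RHS]trmxK -!trmx_mul mulmxA -mulmxA map_from_mx.
  by rewrite -(tail_out sB b) tail_xx.
have Mx (b : {b | b \in B}) : (M b)^T *m Rv i = Rv (head (val b)) *m (xx (val b))^T.
  by rewrite xM !mulmxA RvK mul1mx.
apply/eqP; rewrite eqn_leq !mxrankS //.
  apply/sumsmx_subP => b bB; rewrite (xM (exist _ b bB)) ME trmx_mul.
  apply/submxP; exists ((Rv (head b))^T *m (proj_mx U (exist _ b bB))^T); by rewrite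
    !mulmxA.
rewrite fE raddf_sum /= mulmx_suml summx_sub // => b _; rewrite trmx_mul -mulmxA Mx mulmxA.
by apply: submx_trans (submxMl _ _) (sumsmx_sup (val b) (valP b) _).
Qed.

Hypothesis loopless_Q : loopless Q.
Hypothesis indX : indecomposable X.
Hypothesis tits1 : tits (@Defs.head Q) (@tail Q) (fun i => dim (X i)) = 1.

Let tits1' : tits (@Defs.head Q) (@tail Q) (fun i => \rank (vertex_proj X i)) = 1.
Proof.
by rewrite -[RHS]tits1; congr (_ - _); apply: eq_bigr => j _; rewrite !rank_vertex_proj.
Qed.

(** The rank of the map out of a vertex is that of its transpose, a map into the
    same vertex for the opposite quiver. *)
Theorem indecomposable_max_rank_type : max_rank_type X.
Proof.
have repX := rep_mxrep X; have indM := rep_mxindec indX.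
split=> [i A sA|i B sB]; rewrite /max_rank.
  rewrite rank_in_fun dim_dirsum dimvf -(big_sub A (fun a => dim (X (tail a)))).
  rewrite (@mxindec_max_rank _ _ _ _ _ i _ _ _ A repX indM _ loopless_Q tits1').
    by rewrite rank_vertex_proj; congr minn; apply: eq_bigr => a _; rewrite
      rank_vertex_proj.
  by move=> a aA; move/subsetP/(_ _ aA): sA; rewrite inE => /eqP.
rewrite rank_out_fun dim_dirsum dimvf minnC -(big_sub B (fun b => dim (X (head b)))).
rewrite (@mxindec_max_rank _ _ _ _ _ i _ _ _ B (mxrep_tr repX) (mxindec_tr repX indM)).
- rewrite mxrank_tr rank_vertex_proj; congr minn; apply: eq_bigr => b _.
  by rewrite mxrank_tr rank_vertex_proj.
- by move=> b bB; move/subsetP/(_ _ bB): sB; rewrite inE => /eqP.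
- by move=> a; rewrite eq_sym.
- rewrite -[RHS]tits1; congr (_ - _); apply: eq_bigr => j _; rewrite !mxrank_tr
  !rank_vertex_proj //.
  by rewrite mulrC.
Qed.

End MaxRank.

(** * Real roots *)

Section RealRootForm.
Variable Q : quiver.
Implicit Types alpha beta gamma : {ffun vertex Q -> int}.

Lemma euler_formDl alpha beta gamma :
  euler_form (alpha + beta) gamma = euler_form alpha gamma + euler_form beta gamma.
Proof.
rewrite /euler_form addrACA -opprD -!big_split.
by congr (_ - _); apply: eq_bigr => i _; rewrite ffunE mulrDl.
Qed.

Lemma euler_formDr alpha beta gamma :
  euler_form gamma (alpha + beta) = euler_form gamma alpha + euler_form gamma beta.
Proof.
rewrite /euler_form addrACA -opprD -!big_split.
by congr (_ - _); apply: eq_bigr => i _; rewrite ffunE mulrDr.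
Qed.

Lemma euler_formZl alpha beta m : euler_form (alpha *~ m) beta = m * euler_form alpha beta.
Proof.
rewrite /euler_form mulrBr !mulr_sumr; congr (_ - _); apply: eq_bigr => i _;
  by rewrite ffunMzE -mulrzr -mulrzl; ring.
Qed.

Lemma euler_formZr alpha beta m : euler_form beta (alpha *~ m) = m * euler_form beta alpha.
Proof.
rewrite /euler_form mulrBr !mulr_sumr; congr (_ - _); apply: eq_bigr => i _;
  by rewrite ffunMzE -mulrzr -mulrzl; ring.
Qed.

Hypothesis loopless_Q : loopless Q.

Lemma euler_form_simple (i : vertex Q) : euler_form (simple_root i) (simple_root i) = 1.
Proof.
rewrite /euler_form (bigD1 i) //= !ffunE eqxx mulr1 big1 => [|j /negPf ne]; last first.
  by rewrite ffunE ne mul0r.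
rewrite big1 ?subr0 // => a _; rewrite !ffunE.
have := loopless_Q a; case: (tail a =P i) => [->|_] ; last by rewrite mul0r.
by rewrite eq_sym => /negPf ->; rewrite mulr0.
Qed.

Lemma euler_form_reflection (i : vertex Q) alpha :
  euler_form (reflection i alpha) (reflection i alpha) = euler_form alpha alpha.
Proof.
rewrite /reflection -mulrNz !(euler_formDl, euler_formDr, euler_formZl, euler_formZr).
rewrite euler_form_simple /sym_form; ring.
Qed.

Lemma euler_form_weyl w : weyl w -> forall alpha, euler_form (w alpha) (w alpha) =
  euler_form alpha alpha.
Proof.
elim=> {w} [|i|w w' _ IHw _ IHw'|w w' _ IHw _ w'K] alpha //=.
- exact: euler_form_reflection.
- by rewrite IHw IHw'.
- by rewrite -[RHS]/(euler_form alpha alpha) -{3 4}(w'K alpha) IHw.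
Qed.

Lemma real_root_form alpha : positive_real_root alpha -> euler_form alpha alpha = 1.
Proof. by case=> -[w [i [wP ->]]] _; rewrite (euler_form_weyl wP) euler_form_simple. Qed.

End RealRootForm.

Theorem theoremA (k : fieldType) (Q : quiver)
    (alpha : {ffun vertex Q -> int}) :
  loopless Q -> positive_real_root alpha ->
  forall X : rep k Q,
    indecomposable X -> dim_vector X = alpha -> max_rank_type X.
Proof.
move=> loopless_Q root_alpha X indX dimX; apply: indecomposable_max_rank_type => //.
rewrite -(real_root_form loopless_Q root_alpha) -dimX; congr (_ - _).
  by apply: eq_bigr => i _; rewrite !ffunE !dimvf.
by apply: eq_bigr => a _; rewrite !ffunE !dimvf.
Qed.
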